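(* Let $(\mathbb{S}^2,g)$ be the standard two sphere and let $K$ be a $C^1$ function on $\mathbb{S}^2$. If $K$ does not satisfy the Kazdan-Warner type condition, then there is no $C^2$ solution $u$ to the equation $$\sigma_2(g_u^{-1}A_{g_u})=K(x),\quad \lambda(g_u^{-1}A_{g_u})\in\Gamma_2\quad\text{on }\mathbb{S}^2.$$
   Context: $(\mathbb{S}^2,g)$ is the standard round two sphere, with Gaussian curvature $K_g\equiv 1$. For a function $u$ on $\mathbb{S}^2$, $g_u=e^ug$ and $$A_{g_u}:=-\nabla_{g}^2u+\tfrac{1}{2}du\otimes du-\tfrac{1}{4}|\nabla_{g} u|^2g+K_{g} g .$$ $\lambda(g_u^{-1}A_{g_u})=(\lambda_1,\lambda_2)$ denotes the eigenvalues of $g_u^{-1}A_{g_u}$, $\sigma_2(g_u^{-1}A_{g_u})=\lambda_1\lambda_2$, and $\Gamma_2=\{(\lambda_1,\lambda_2):\lambda_1>0,\lambda_2>0\}$. A function $K$ on $\mathbb{S}^2$ satisfies the Kazdan-Warner type condition if there exists some positive $C^2$ function $f$ on $\mathbb{S}^2$ satisfying $\int_{\mathbb{S}^2}X(K)f\,dV_{g}=0$ for any conformal Killing vector field $X$ on $\mathbb{S}^2$, where $X(K)$ is the derivative of $K$ in the direction $X$. *)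

(* Defs.v *)
From HB Require Import structures.
From mathcomp Require Import all_boot all_order all_algebra.
From mathcomp Require Import all_classical all_reals all_analysis.
Set Implicit Arguments.
Unset Strict Implicit.
Unset Printing Implicit Defensive.
Import Order.TTheory GRing.Theory Num.Theory.
Import numFieldNormedType.Exports.
Local Open Scope classical_set_scope.
Local Open Scope ring_scope.

(* S^2 is the unit sphere of R^3 with the induced metric.  A function or vector
   field on S^2 is represented by a total function on 'rV[R]_3; every notion
   below depends only on its restriction to the sphere.  The library norm on
   'rV[R]_3 is the max norm, hence the explicit Euclidean product. *)
Definition dot (R : realType) (v w : 'rV[R]_3) : R := \sum_(i < 3) v 0 i * w 0 i.

Definition enorm (R : realType) (v : 'rV[R]_3) : R := Num.sqrt (dot v v).

Definition sphere (R : realType) : set 'rV[R]_3 := [set p | dot p p = 1].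

Definition tangent (R : realType) (p : 'rV[R]_3) : set 'rV[R]_3 :=
  [set V | dot p V = 0].

Definition tproj (R : realType) (p V : 'rV[R]_3) : 'rV[R]_3 := V - dot p V *: p.

(* Extension of a function on S^2 to R^3 \ {0}, constant along rays.  Since
   x |-> x / |x| is a smooth retraction of R^3 \ {0} onto S^2, h is C^k on S^2
   iff [ext h] is C^k on R^3 \ {0}, and for V tangent to S^2 at p the derivative
   of h along V is ['D_V (ext h) p]. *)
Definition ext (R : realType) (T : Type) (h : 'rV[R]_3 -> T) : 'rV[R]_3 -> T :=
  fun x => h ((enorm x)^-1 *: x).

Definition basis_vec (R : realType) (i : 'I_3) : 'rV[R]_3 := delta_mx 0 i.

(* Class C^k on the open set A. *)
Fixpoint Ck_on (R : realType) (A : set 'rV[R]_3) (k : nat)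
    (h : 'rV[R]_3 -> R) : Prop :=
  match k with
  | 0%N => forall x, A x -> {for x, continuous h}
  | k'.+1 => (forall x, A x -> differentiable h x) /\
             (forall i : 'I_3, Ck_on A k' (fun x => 'D_(basis_vec R i) h x))
  end.

Definition Ck_sphere (R : realType) (k : nat) (h : 'rV[R]_3 -> R) : Prop :=
  Ck_on [set x | x != 0] k (ext h).

Definition dirder (R : realType) (h : 'rV[R]_3 -> R) (p V : 'rV[R]_3) : R :=
  'D_V (ext h) p.

(* Tangential on the sphere, because [ext h] is constant along rays. *)
Definition grad (R : realType) (h : 'rV[R]_3 -> R) (p : 'rV[R]_3) : 'rV[R]_3 :=
  \row_(i < 3) dirder h p (basis_vec R i).

(* Levi-Civita connection of the induced metric: tangential part of the ambient
   derivative. *)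
Definition covd (R : realType) (Y : 'rV[R]_3 -> 'rV[R]_3)
    (p V : 'rV[R]_3) : 'rV[R]_3 :=
  tproj p ('D_V (ext Y) p).

Definition hess (R : realType) (h : 'rV[R]_3 -> R) (p V W : 'rV[R]_3) : R :=
  dot (covd (grad h) p V) W.

Definition conf_metric (R : realType) (u : 'rV[R]_3 -> R)
    (p V W : 'rV[R]_3) : R :=
  expR (u p) * dot V W.

Definition gauss_curvature (R : realType) (p : 'rV[R]_3) : R := 1.

Definition A_tensor (R : realType) (u : 'rV[R]_3 -> R) (p V W : 'rV[R]_3) : R :=
  - hess u p V W
  + 2^-1 * (dirder u p V * dirder u p W)
  - 4^-1 * dot (grad u p) (grad u p) * dot V W
  + gauss_curvature p * dot V W.

(* The rows of E form a basis of T_p S^2. *)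
Definition tangent_basis (R : realType) (p : 'rV[R]_3) (E : 'M[R]_(2, 3)) : Prop :=
  (forall i, tangent p (row i E)) /\ row_free E.

Definition form_mx (R : realType) (E : 'M[R]_(2, 3))
    (B : 'rV[R]_3 -> 'rV[R]_3 -> R) : 'M[R]_2 :=
  \matrix_(i, j) B (row i E) (row j E).

(* l lists, with multiplicity, the eigenvalues of the endomorphism G^-1 B of
   T_p S^2, for bilinear forms B and G on T_p S^2 with G nondegenerate; its
   characteristic polynomial does not depend on the basis. *)
Definition eigenvalues_at (R : realType) (p : 'rV[R]_3)
    (G B : 'rV[R]_3 -> 'rV[R]_3 -> R) (l : R * R) : Prop :=
  forall E : 'M[R]_(2, 3), tangent_basis p E ->
    char_poly (invmx (form_mx E G) *m form_mx E B) =
      ('X - (l.1)%:P) * ('X - (l.2)%:P).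

Definition sigma2 (R : realType) (l : R * R) : R := l.1 * l.2.

Definition Gamma2 (R : realType) : set (R * R) := [set l | 0 < l.1 /\ 0 < l.2].

Definition solves_sigma2 (R : realType) (K u : 'rV[R]_3 -> R) : Prop :=
  forall p, sphere p ->
    exists l : R * R,
      [/\ eigenvalues_at p (conf_metric u p) (A_tensor u p) l,
          sigma2 l = K p & Gamma2 l].

Definition lie_metric (R : realType) (X : 'rV[R]_3 -> 'rV[R]_3)
    (p V W : 'rV[R]_3) : R :=
  dot (covd X p V) W + dot V (covd X p W).

Definition conformal_killing (R : realType) (X : 'rV[R]_3 -> 'rV[R]_3) : Prop :=
  [/\ forall p, sphere p -> tangent p (X p),
      forall (k : nat) (i : 'I_3), Ck_sphere k (fun p => X p 0 i) &
      exists phi : 'rV[R]_3 -> R, forall p V W, sphere p ->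
        tangent p V -> tangent p W -> lie_metric X p V W = phi p * dot V W].

Definition spherical (R : realType) (t s : R) : 'rV[R]_3 :=
  \row_(i < 3) [:: sin t * cos s; sin t * sin s; cos t]`_i.

(* Integration against dV_g = sin t dt ds, with t the polar angle and s the
   azimuth. *)
Definition sphere_integral (R : realType) (h : 'rV[R]_3 -> R) : R :=
  \int[@lebesgue_measure R]_(t in `[0, pi])
    \int[@lebesgue_measure R]_(s in `[0, 2 * pi]) (h (spherical t s) * sin t).

Definition kazdan_warner (R : realType) (K : 'rV[R]_3 -> R) : Prop :=
  exists f : 'rV[R]_3 -> R,
    [/\ Ck_sphere 2 f,
        forall p, sphere p -> 0 < f p &
        forall X : 'rV[R]_3 -> 'rV[R]_3, conformal_killing X ->
          sphere_integral (fun p => dirder K p (X p) * f p) = 0].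

(* Main.v *)
Require Import Defs.
From mathcomp Require Import all_boot all_order all_algebra.
From mathcomp Require Import all_classical all_reals all_analysis.
From mathcomp Require Import ring lra.
Set Implicit Arguments.
Unset Strict Implicit.
Unset Printing Implicit Defensive.
Import Order.TTheory GRing.Theory Num.Theory.
Import numFieldNormedType.Exports.
Local Open Scope classical_set_scope.
Local Open Scope ring_scope.


(** The weight [f = e^u] satisfies the Kazdan-Warner condition, because the
equation is a closedness statement in disguise.

Write [y = e^(-u/2)], so that [e^u g = y^-2 g], and regard the metric [e^u g]
as the surface [y^-1 (1, p)] of the light cone of R^(3,1).  The null vector
orthogonal to this surface and of product -1 with its points is
[N = (N0, N0 p - y (p - grad u / 2))] with [N0 = y (1 + |grad u|^2 / 4) / 2].
Its differential is the tensor [A] of the metric [e^u g]: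
[dN = n (1, p) - (y / 2) A], where [n = - (y / 4) A (grad u)] ([sder_cone0],
[svder_cone]).  Hence the 2-forms [dN_a /\ dN_b] are [det A] times explicit
coefficients, that is, [K e^(2u)] times these coefficients.

A conformal Killing field is an element of the Lie algebra so(3,1): on the
sphere it is [r x p + c - (c . p) p] for two constant vectors [r] and [c].  For
such a field [X(K) e^u] is a combination, with coefficients the entries of [r]
and [c], of the densities of [d(K e^u) /\ d p_i], [d(K e^u p_i) /\ d p_j] and
[dN_a /\ dN_b] ([kazdan_warner_frame]).  By Stokes' theorem all of these have
integral 0.

Two points need care.  Since [u] is only C^2, the functions [N_a] and [K e^u]
are only C^1; Stokes' theorem [int df /\ dh = 0] is therefore proved for C^1
functions, integrating by parts in one variable only ([Rintegral_wedge],
[integral2_jac]).  And the normal form of a conformal Killing field [X]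
([conformal_killing_on_sphere]) is a global fact: with [a] and [b] half the
divergence and half the curl of [X], and [f^] the extension of [f] homogeneous
of degree 1, the gradients [r] of [b^] and [-c] of [a^] express [X] pointwise
([killing_hgrad]) and satisfy Cauchy-Riemann equations
([killing_hgrad_entries]).  By these the sum of the densities of
[d(grad a^)_i /\ d(grad b^)_i] is a sum of squares; as its integral is 0, [r]
and [c] are constant. *)

(** * C^k functions on an open subset of R^3 *)

Section CkCalculus.
Variable R : realType.
Implicit Types (A : set 'rV[R]_3) (f g h : 'rV[R]_3 -> R).

(** Differentiability is local; this is the case of a function vanishing near a
point, from which [near_eq_differentiable] follows by subtraction. *)
Lemma differentiable_near0 f x : (\forall y \near x, f y = 0) ->
  differentiable f x.
Proof.
move=> f0.
have fx0 : f x = 0 by exact: nbhs_singleton f0.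
have lo : f \o shift x = cst (f x) + (\0 : 'rV[R]_3 -> R) +o_ (0 : 'rV[R]_3) id.
  apply/eqaddoE; rewrite fx0; apply/funext => y /=.
  rewrite /cst /= !fctE !add0r littleoE //.
  move=> e e0; move: f0; rewrite (near_shift 0)/= subr0 => f0.
  near=> z; have -> /= : f (z + x) = 0 by near: z; exact: f0.
  by rewrite normr0 mulr_ge0 // ltW.
have cst0 : continuous (\0 : 'rV[R]_3 -> R) by exact: cst_continuous.
by apply/diff_locallyP; rewrite (diff_unique cst0 lo).
Unshelve. all: by end_near. Qed.

Lemma near_eq_differentiable f g x : (\forall y \near x, f y = g y) ->
  differentiable f x -> differentiable g x.
Proof.
move=> fg df; rewrite -[g](subrK f); apply: differentiableD => //.
apply: differentiable_near0; near=> y.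
have -> : (g - f) y = g y - f y by [].
by rewrite (near fg y) ?subrr.
Unshelve. all: by end_near. Qed.

(** The set must be open: derivatives at a point see a whole neighborhood. *)
Lemma Ck_on_congr A k f g : open A -> (forall x, A x -> f x = g x) ->
  Ck_on A k f -> Ck_on A k g.
Proof.
move=> oA.
have near_eq : forall f g, (forall x, A x -> f x = g x) ->
    forall x, A x -> \forall y \near x, f y = g y.
  move=> {}f {}g fg x Ax; have Anx : \forall y \near x, A y by exact: open_nbhs_nbhs.
  by apply: filterS Anx.
elim: k f g => [|k IH] f g fg /=.
  move=> cf x Ax; have cfx : f y @[y --> x] --> f x := cf x Ax.
  suff : g y @[y --> x] --> g x by [].
  rewrite -(fg _ Ax); apply: cvg_trans cfx; apply: (@near_eq_cvg _ _ (nbhs x)).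
  by move: (near_eq _ _ fg x Ax); apply: filterS => y fgy; rewrite /= fgy.
move=> [df cf]; split=> [x Ax|i].
  exact: near_eq_differentiable (near_eq _ _ fg _ Ax) (df x Ax).
apply: IH (cf i) => x Ax; apply: near_eq_derive.
exact: near_eq fg _ Ax.
Qed.

Lemma Ck_on_differentiable A k f x : Ck_on A k.+1 f -> A x -> differentiable f x.
Proof. by move=> [+ _] => /[apply]. Qed.

Lemma Ck_on_continuous A k f x : Ck_on A k f -> A x -> {for x, continuous f}.
Proof.
case: k => [|k] cf Ax; first exact: cf.
exact/differentiable_continuous/(Ck_on_differentiable cf).
Qed.

Lemma Ck_onS A k f : Ck_on A k.+1 f -> Ck_on A k f.
Proof.
elim: k f => [|k IH] f cf.
  by move=> x Ax; exact: Ck_on_continuous cf Ax.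
by case: cf => df cf; split=> // i; exact/IH/cf.
Qed.

Lemma Ck_on_cst A k c : Ck_on A k (fun=> c).
Proof.
elim: k c => [|k IH] c /=; first by move=> x _; exact: cst_continuous.
split=> [x _|i]; first exact: differentiable_cst.
under eq_fun do rewrite derive_cst.
exact: IH.
Qed.

Lemma Ck_onD A k f g : open A -> Ck_on A k f -> Ck_on A k g ->
  Ck_on A k (fun x => f x + g x).
Proof.
move=> oA; elim: k f g => [|k IH] f g /=.
  by move=> cf cg x Ax; exact: continuousD (cf _ Ax) (cg _ Ax).
move=> [df cf] [dg cg]; split=> [x Ax|i].
  by apply: differentiableD; [exact: df|exact: dg].
apply: Ck_on_congr oA _ (IH _ _ (cf i) (cg i)) => x Ax.
by rewrite -deriveD; [|apply: diff_derivable; exact: df|apply: diff_derivable; exact: dg].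
Qed.

Lemma Ck_onM A k f g : open A -> Ck_on A k f -> Ck_on A k g ->
  Ck_on A k (fun x => f x * g x).
Proof.
move=> oA; elim: k f g => [|k IH] f g.
  by move=> cf cg x Ax; exact: continuousM (cf _ Ax) (cg _ Ax).
move=> Cf Cg; have [df cf] := Cf; have [dg cg] := Cg; split=> [x Ax|i].
  by apply: differentiableM; [exact: df|exact: dg].
apply: Ck_on_congr oA _
  (Ck_onD oA (IH _ _ (Ck_onS Cf) (cg i)) (IH _ _ (Ck_onS Cg) (cf i))) => x Ax.
by rewrite -deriveM; [|apply: diff_derivable; exact: df|apply: diff_derivable; exact: dg].
Qed.

Lemma Ck_onN A k f : open A -> Ck_on A k f -> Ck_on A k (fun x => - f x).
Proof.
move=> oA cf; apply: Ck_on_congr oA _ (Ck_onM oA (Ck_on_cst A k (-1)) cf).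
by move=> x _; rewrite mulN1r.
Qed.

Lemma derive_coord (i : 'I_3) (x v : 'rV[R]_3) :
  'D_v (fun y : 'rV[R]_3 => y 0 i) x = v 0 i.
Proof.
by have := derive_mx (@derivable_id _ _ x v); rewrite derive_id => /matrixP/(_ 0 i); rewrite mxE => <-.
Qed.

Lemma Ck_on_coord A k i : Ck_on A k (fun x => x 0 i).
Proof.
case: k => [|k]; first by move=> x _; exact: coord_continuous.
split=> [x _|j]; first exact: differentiable_coord.
rewrite (_ : (fun x => _) = fun=> (basis_vec R j) 0 i); first exact: Ck_on_cst.
by apply/funext => x; rewrite derive_coord.
Qed.

(** The derivative of [expR \o f] is [expR \o f] times that of [f], so the
order of differentiability climbs by induction. *)
Lemma Ck_on_expR A k f : open A -> Ck_on A k f ->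
  Ck_on A k (fun x => expR (f x)).
Proof.
move=> oA; elim: k f => [|k IH] f.
  move=> cf x Ax; apply: (@continuous_comp _ _ _ f expR); first exact: cf.
  exact: continuous_expR.
move=> Cf; have [df cf] := Cf.
have dexp y : differentiable expR (y : R^o) by apply/derivable1_diffP; exact: derivable_expR.
have dexpf x : A x -> differentiable (fun x => expR (f x)) x.
  by move=> Ax; apply: differentiable_comp; [exact: df|exact: dexp].
split=> [x Ax|i]; first exact: dexpf.
apply: Ck_on_congr oA _ (Ck_onM oA (IH _ (Ck_onS Cf)) (cf i)) => x Ax.
rewrite deriveE; last exact: df.
rewrite deriveE; last exact: dexpf.
rewrite (@diff_comp _ _ _ _ f expR) //; last exact: df.
by rewrite deriv1E // derive1E derive_val mulrC.
Qed.

End CkCalculus.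

(** * Chain rule and symmetry of second derivatives *)

Section Calculus3.
Variable R : realType.
Implicit Types (A : set 'rV[R]_3) (f g h : 'rV[R]_3 -> R) (x v w : 'rV[R]_3).

Lemma chain_differentiable f (g : R -> R) x dg :
  differentiable f x -> is_derive (f x) 1 g dg ->
  differentiable (fun y => g (f y)) x.
Proof.
move=> df [dgx _]; apply: (@differentiable_comp _ _ _ _ f g) => //.
exact/derivable1_diffP.
Qed.

Lemma chain_derive f (g : R -> R) x dg v :
  differentiable f x -> is_derive (f x) 1 g dg ->
  'D_v (fun y => g (f y)) x = dg * 'D_v f x.
Proof.
move=> df dgx; have [ex <-] := dgx.
rewrite deriveE; last exact: chain_differentiable df dgx.
rewrite (@diff_comp _ _ _ _ f g) //; last exact/derivable1_diffP.
by rewrite /= deriv1E // derive1E -deriveE// mulrC.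
Qed.

Lemma row_basis v : v = \sum_(i < 3) v 0 i *: basis_vec R i.
Proof. by rewrite {1}[v]row_sum_delta. Qed.

Lemma derive_basis f x v : differentiable f x ->
  'D_v f x = \sum_(i < 3) v 0 i * 'D_(basis_vec R i) f x.
Proof.
move=> df; rewrite deriveE// {1}[v]row_basis linear_sum /=.
by apply: eq_bigr => i _; rewrite linearZ /= -deriveE.
Qed.

Lemma Ck_on_sum A k n (F : 'I_n -> 'rV[R]_3 -> R) : open A ->
  (forall i, Ck_on A k (F i)) -> Ck_on A k (fun x => \sum_(i < n) F i x).
Proof.
move=> oA; elim: n F => [|n IH] F cF.
  by under eq_fun do rewrite big_ord0; exact: Ck_on_cst.
under eq_fun do rewrite big_ord_recl.
by apply: Ck_onD => //; exact: IH.
Qed.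

Lemma Ck_on_derive A k f v : open A -> Ck_on A k.+1 f ->
  Ck_on A k (fun x => 'D_v f x).
Proof.
move=> oA cf; apply: (@Ck_on_congr _ A k
    (fun x => \sum_(i < 3) v 0 i * 'D_(basis_vec R i) f x)) => // [x Ax|].
  by rewrite -derive_basis//; exact: Ck_on_differentiable cf Ax.
apply: Ck_on_sum => // i; apply: Ck_onM => //; first exact: Ck_on_cst.
by case: cf => _; exact.
Qed.

Lemma is_derive_line f x v (a : R) : differentiable f (x + a *: v) ->
  is_derive a 1 (fun b : R => f (x + b *: v)) ('D_v f (x + a *: v)).
Proof.
move=> df.
pose l := fun b : R => x + b *: v.
have [dl El] : is_diff a l ( *:%R^~ v).
  have -> : *:%R^~ v = (0 + *:%R^~ v : R -> _) by rewrite add0r.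
  exact: is_diffD.
have dc : differentiable (f \o l) a by exact: differentiable_comp.
apply: (@DeriveDef _ _ _ a 1 (f \o l)); first exact: diff_derivable.
by rewrite deriveE// diff_comp//= El scale1r -deriveE.
Qed.

Lemma line_MVT (phi dphi : R -> R) (h : R) : 0 < h ->
  (forall a, 0 <= a <= h -> is_derive a 1 phi (dphi a)) ->
  exists2 a, 0 <= a <= h & phi h - phi 0 = h * dphi a.
Proof.
move=> h0 dP.
have dP' a : a \in `]0, h[ -> is_derive a 1 phi (dphi a).
  by rewrite in_itv/= => /andP[a0 ah]; apply: dP; rewrite !ltW.
have cP : {within `[0, h], continuous phi}.
  apply: derivable_within_continuous => a; rewrite in_itv/= => ah.
  by have [] := dP a ah.
have [a] := MVT h0 dP' cP.
rewrite in_itv/= => /andP[a0 ah] E; exists a; first by rewrite !ltW.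
by rewrite E subr0 mulrC.
Qed.

(** The mean value theorem, applied first along [v] to the difference of [f]
between two parallel sides, then along [w] to the derivative. *)
Lemma second_difference f x v w (h : R) : 0 < h ->
  (forall a b : R, 0 <= a <= h -> 0 <= b <= h ->
    differentiable f (x + a *: v + b *: w) /\
    differentiable (fun y => 'D_v f y) (x + a *: v + b *: w)) ->
  exists a b : R, [/\ 0 <= a <= h, 0 <= b <= h &
   f (x + h *: v + h *: w) - f (x + h *: v) - f (x + h *: w) + f x =
   h * h * 'D_w (fun y => 'D_v f y) (x + a *: v + b *: w)].
Proof.
move=> h0 df.
have hh : 0 <= h <= h by rewrite lexx ltW.
have zz : (0 : R) <= 0 <= h by rewrite lexx ltW.
pose phi (a : R) := f (x + h *: w + a *: v) - f (x + a *: v).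
pose dphi (a : R) := 'D_v f (x + h *: w + a *: v) - 'D_v f (x + a *: v).
have dphiP (a : R) : 0 <= a <= h -> is_derive a 1 phi (dphi a).
  move=> ah; apply: is_deriveB; apply: is_derive_line.
    by rewrite addrAC; exact: (df a h ah hh).1.
  by have := (df a 0 ah zz).1; rewrite scale0r addr0.
have [a ah E1] := line_MVT h0 dphiP.
pose psi (b : R) := 'D_v f (x + a *: v + b *: w).
pose dpsi (b : R) := 'D_w (fun y => 'D_v f y) (x + a *: v + b *: w).
have dpsiP (b : R) : 0 <= b <= h -> is_derive b 1 psi (dpsi b).
  by move=> bh; apply: is_derive_line; exact: (df a b ah bh).2.
have [b bh E2] := line_MVT h0 dpsiP.
exists a, b; split=> //.
move: E1 E2; rewrite /phi /dphi /psi /dpsi !scale0r !addr0.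
rewrite [x + h *: w + h *: v]addrAC [x + h *: w + a *: v]addrAC => E1 E2.
by rewrite -mulrA -E2 -E1 opprB !addrA [LHS]addrAC.
Qed.

Lemma ler_dist_half (a b c e : R) : `|a - c| < e / 2 -> `|b - c| < e / 2 ->
  `|a - b| < e.
Proof.
rewrite [`|b - c|]distrC => ac cb; rewrite -(subrKA c) (splitr e).
exact: le_lt_trans (ler_normD _ _) (ltrD ac cb).
Qed.

(** The second difference of [f] over a small parallelogram does not depend on
the order of the two sides, and by [second_difference] it gives either mixed
derivative at some nearby point; continuity of both does the rest. *)
Lemma derive_commute A f x v w : open A -> Ck_on A 2 f -> A x ->
  'D_w (fun y => 'D_v f y) x = 'D_v (fun y => 'D_w f y) x.
Proof.
move=> oA cf Ax.
have cv := Ck_on_derive v oA cf; have cw := Ck_on_derive w oA cf.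
have cvw := Ck_on_continuous (Ck_on_derive w oA cv) Ax.
have cwv := Ck_on_continuous (Ck_on_derive v oA cw) Ax.
apply/eqP; rewrite -subr_eq0 -normr_le0; apply/ler_addgt0Pl => e e0; rewrite addr0.
have e2 : 0 < e / 2 by rewrite divr_gt0.
pose V1 := [set y | `|'D_w (fun y => 'D_v f y) x - 'D_w (fun y => 'D_v f y) y| < e / 2].
pose V2 := [set y | `|'D_v (fun y => 'D_w f y) x - 'D_v (fun y => 'D_w f y) y| < e / 2].
have n1 : nbhs x V1 by move/cvgrPdist_lt: cvw; apply.
have n2 : nbhs x V2 by move/cvgrPdist_lt: cwv; apply.
have nA : nbhs x A by exact: open_nbhs_nbhs.
have /nbhs_ballP[d /= d0 bd] : nbhs x (A `&` (V1 `&` V2)).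
  by apply: filterI => //; exact: filterI.
(* For h = d / (2 M) the parallelogram with sides h v and h w lies in the ball
   of radius d. *)
pose M := `|v| + `|w| + 1.
have M0 : 0 < M by rewrite ltr_wpDl// addr_ge0.
pose h := d / (2 * M).
have h0 : 0 < h by rewrite divr_gt0// mulr_gt0.
have small (a b : R) : 0 <= a <= h -> 0 <= b <= h ->
    (A `&` (V1 `&` V2)) (x + a *: v + b *: w).
  move=> /andP[a0 ah] /andP[b0 bh]; apply: bd; rewrite -ball_normE/=.
  rewrite -addrA opprD addNKr normrN.
  apply: (le_lt_trans (ler_normD _ _)); rewrite !normrZ !ger0_norm//.
  apply: (@le_lt_trans _ _ (h * M)).
    rewrite /M !mulrDr mulr1; apply: ler_wpDr; first exact: ltW.
    by rewrite lerD// ler_wpM2r.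
  have -> : h * M = d / 2 by rewrite /h; field; rewrite gt_eqF.
  by rewrite ltr_pdivrMr// ltr_pMr// ltr1n.
have small' a b (ha : 0 <= a <= h) (hb : 0 <= b <= h) :
    (A `&` (V1 `&` V2)) (x + a *: w + b *: v).
  by rewrite addrAC; exact: small.
have [a [b [ha hb E1]]] : exists a b : R, [/\ 0 <= a <= h, 0 <= b <= h &
   f (x + h *: v + h *: w) - f (x + h *: v) - f (x + h *: w) + f x =
   h * h * 'D_w (fun y => 'D_v f y) (x + a *: v + b *: w)].
  apply: second_difference => // a b ha hb; have [Ay _] := small a b ha hb.
  split; first exact: Ck_on_differentiable cf Ay.
  exact: Ck_on_differentiable cv Ay.
have [a' [b' [ha' hb' E2]]] : exists a b : R, [/\ 0 <= a <= h, 0 <= b <= h &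
   f (x + h *: w + h *: v) - f (x + h *: w) - f (x + h *: v) + f x =
   h * h * 'D_v (fun y => 'D_w f y) (x + a *: w + b *: v)].
  apply: second_difference => // a' b' ha' hb'; have [Ay _] := small' a' b' ha' hb'.
  split; first exact: Ck_on_differentiable cf Ay.
  exact: Ck_on_differentiable cw Ay.
have E : 'D_w (fun y => 'D_v f y) (x + a *: v + b *: w) =
         'D_v (fun y => 'D_w f y) (x + a' *: w + b' *: v).
  apply: (@mulfI _ (h * h)); first by rewrite mulf_neq0// gt_eqF.
  rewrite -[LHS]E1 -[RHS]E2; congr (_ + _).
  by rewrite [LHS]addrAC (addrAC x (h *: w)).
have [_ [+ _]] := small _ _ ha hb; have [_ [_ +]] := small' _ _ ha' hb'.
rewrite /V1 /V2 /= E => s2 s1.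
exact: ltW (ler_dist_half s1 s2).
Qed.

End Calculus3.

(** * Functions on the sphere *)

Section SphereCalculus.
Variable R : realType.
Implicit Types (f g h : 'rV[R]_3 -> R) (x p v w : 'rV[R]_3).

Lemma sum3 (V : nmodType) (F : 'I_3 -> V) : \sum_(i < 3) F i = F 0 + F 1 + F 2.
Proof.
rewrite !big_ord_recl big_ord0 addr0 addrA.
by congr (F _ + F _ + F _); exact/val_inj.
Qed.

Lemma ord3P (P : 'I_3 -> Prop) : P 0 -> P 1 -> P 2 -> forall i, P i.
Proof.
move=> P0 P1 P2; case=> -[|[|[|//]]] i3; [have -> : Ordinal i3 = 0|
  have -> : Ordinal i3 = 1|have -> : Ordinal i3 = 2] => //; exact: val_inj.
Qed.

Lemma dotE v w : dot v w = v 0 0 * w 0 0 + v 0 1 * w 0 1 + v 0 2 * w 0 2.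
Proof. exact: sum3. Qed.

Lemma dot_gt0 x : x != 0 -> 0 < dot x x.
Proof.
move=> x0; have := sqr_ge0 (x 0 0); have := sqr_ge0 (x 0 1); have := sqr_ge0 (x 0 2).
rewrite dotE -!expr2 => h2 h1 h0.
rewrite lt_neqAle !addr_ge0// andbT eq_sym; apply: contra_neq x0 => s0.
have [z0 z1 z2] : [/\ x 0 0 ^+ 2 = 0, x 0 1 ^+ 2 = 0 & x 0 2 ^+ 2 = 0] by split; lra.
apply/rowP; apply: ord3P; rewrite mxE; apply/eqP; rewrite -sqrf_eq0; exact/eqP.
Qed.

Lemma enorm_gt0 x : x != 0 -> 0 < enorm x.
Proof. by move=> /dot_gt0; rewrite /enorm sqrtr_gt0. Qed.

Lemma enorm_sqr x : enorm x * enorm x = dot x x.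
Proof.
rewrite -expr2 /enorm sqr_sqrtr// dotE -!expr2.
by rewrite !addr_ge0// sqr_ge0.
Qed.

Lemma dotZl (a : R) v w : dot (a *: v) w = a * dot v w.
Proof. rewrite !dotE !mxE; ring. Qed.

Lemma dotC v w : dot v w = dot w v.
Proof. rewrite !dotE; ring. Qed.

Lemma dotDl v v' w : dot (v + v') w = dot v w + dot v' w.
Proof. rewrite !dotE !mxE; ring. Qed.

Lemma enormZ (c : R) x : 0 <= c -> enorm (c *: x) = c * enorm x.
Proof.
move=> c0; rewrite /enorm dotZl dotC dotZl mulrA -expr2.
by rewrite sqrtrM ?sqr_ge0// sqrtr_sqr ger0_norm.
Qed.

Lemma enorm_sphere p : sphere p -> enorm p = 1.
Proof. by rewrite /enorm => ->; rewrite sqrtr1. Qed.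

Lemma sphere_neq0 p : sphere p -> p != 0.
Proof.
by apply: contraPneq => ->; rewrite /sphere/= dotE !mxE !mul0r !addr0 => /esym/eqP; rewrite oner_eq0.
Qed.

Lemma sphere_normalize x : x != 0 -> sphere ((enorm x)^-1 *: x).
Proof.
move=> x0; rewrite /sphere/= dotZl dotC dotZl -enorm_sqr.
by field; rewrite gt_eqF// enorm_gt0.
Qed.

Lemma ext_sphere (T : Type) (F : 'rV[R]_3 -> T) p : sphere p -> ext F p = F p.
Proof. by move=> sp; rewrite /ext enorm_sphere// invr1 scale1r. Qed.

Lemma ext_scale (T : Type) (F : 'rV[R]_3 -> T) (c : R) x : 0 < c ->
  ext F (c *: x) = ext F x.
Proof.
move=> c0; rewrite /ext enormZ ?ltW// scalerA; congr (F (_ *: _)).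
have [->|n0] := eqVneq (enorm x) 0; first by rewrite mulr0 invr0 mul0r.
by field; rewrite n0 gt_eqF.
Qed.

Definition punctured : set 'rV[R]_3 := [set x | x != 0].

Lemma open_punctured : open punctured.
Proof.
have -> : punctured = ~` [set 0] by apply/seteqP; split=> x /= /eqP.
rewrite openC; exact/accessible_closed_set1/hausdorff_accessible/norm_hausdorff.
Qed.
Hint Resolve open_punctured : core.

Lemma Ck_on_dot k : Ck_on punctured k (fun x => dot x x).
Proof.
under eq_fun do rewrite dotE.
by do !apply: Ck_onD => //; apply: Ck_onM => //; exact: Ck_on_coord.
Qed.

Lemma derive_dot x v : 'D_v (fun y => dot y y) x = 2 * dot x v.
Proof.
have d i : derivable (fun y : 'rV[R]_3 => y 0 i) x v.
  by apply: diff_derivable; exact: differentiable_coord.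
have H i : is_derive x v (fun y : 'rV[R]_3 => y 0 i * y 0 i) (2 * (x 0 i * v 0 i)).
  apply: DeriveDef; first exact: derivableM (d i) (d i).
  by rewrite (deriveM (d i) (d i)) derive_coord /GRing.scale/=; ring.
under eq_fun do rewrite dotE.
have [_ ->] := is_deriveD (is_deriveD (H 0) (H 1)) (H 2).
rewrite dotE; ring.
Qed.

Definition invn (y : R) := (Num.sqrt y)^-1.

(** The function [invn] of the squared norm is the inverse of the norm. *)
Lemma is_derive_invn (y : R) : 0 < y ->
  is_derive y 1 invn (- (2^-1 * invn y ^+ 3)).
Proof.
move=> y0; have s0 : Num.sqrt y != 0 by rewrite gt_eqF// sqrtr_gt0.
have [ds es] := is_derive1_sqrt y0.
apply: DeriveDef; first exact: derivableV.
rewrite deriveV// es /invn /GRing.scale/=; field.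
by [].
Qed.

Lemma derive_invenorm x v : x != 0 ->
  'D_v (fun y => (enorm y)^-1) x = - (dot x v * (enorm x)^-1 ^+ 3).
Proof.
move=> x0.
rewrite (chain_derive v (Ck_on_differentiable (Ck_on_dot 1) x0) (is_derive_invn (dot_gt0 x0))).
rewrite derive_dot /invn -/(enorm x).
by field; rewrite gt_eqF// enorm_gt0.
Qed.

(** The first derivatives of [1 / |x|] are the polynomials [- x_i (1 / |x|)^3]
in [x] and [1 / |x|] itself, whence smoothness by induction on the order. *)
Lemma Ck_on_invenorm k : Ck_on punctured k (fun x => (enorm x)^-1).
Proof.
elim: k => [|k IH].
  move=> x x0; apply: differentiable_continuous.
  exact: chain_differentiable (Ck_on_differentiable (Ck_on_dot 1) x0) (is_derive_invn (dot_gt0 x0)).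
split=> [x x0|i].
  exact: chain_differentiable (Ck_on_differentiable (Ck_on_dot 1) x0) (is_derive_invn (dot_gt0 x0)).
apply: (@Ck_on_congr _ _ _ (fun x => - (x 0 i * ((enorm x)^-1 * ((enorm x)^-1 * (enorm x)^-1))))) => //.
  move=> x x0; rewrite derive_invenorm// exprS expr2; congr (- (_ * _)).
  rewrite /dot (bigD1 i)//= big1 ?addr0 => [|j ji]; rewrite mxE !eqxx ?mulr1//.
  by rewrite (negPf ji) mulr0.
apply: Ck_onN => //; apply: Ck_onM => //; first exact: Ck_on_coord.
by do ! apply: Ck_onM => //.
Qed.

Lemma Ck_on_enorm k : Ck_on punctured k (@enorm R).
Proof.
apply: (@Ck_on_congr _ _ _ (fun x => dot x x * (enorm x)^-1)) => //.
  by move=> x x0; rewrite -enorm_sqr mulfK// gt_eqF// enorm_gt0.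
by apply: Ck_onM => //; [exact: Ck_on_dot|exact: Ck_on_invenorm].
Qed.

(** The norm is constant on the sphere, to first order in tangent directions.
*)
Lemma derive_enorm_tangent p v : sphere p -> dot p v = 0 ->
  'D_v (@enorm R) p = 0.
Proof.
move=> sp pv; have p0 := sphere_neq0 sp.
have -> : 'D_v (@enorm R) p = 'D_v (fun x => dot x x * (enorm x)^-1) p.
  apply: near_eq_derive; near=> x.
  have x0 : x != 0 by near: x; exact: open_nbhs_nbhs.
  by rewrite -enorm_sqr mulfK// gt_eqF// enorm_gt0.
have dd := @diff_derivable _ _ _ _ _ v (Ck_on_differentiable (Ck_on_dot 1) p0).
have di := @diff_derivable _ _ _ _ _ v (Ck_on_differentiable (Ck_on_invenorm 1) p0).
rewrite (deriveM dd di).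
by rewrite derive_dot derive_invenorm// pv mul0r oppr0 mulr0 !scaler0 addr0.
Unshelve. all: by end_near. Qed.

Lemma Ck_sphere_cst k c : Ck_sphere k (fun=> c : R).
Proof. exact: Ck_on_cst. Qed.

Lemma Ck_sphereD k f g : Ck_sphere k f -> Ck_sphere k g ->
  Ck_sphere k (fun p => f p + g p).
Proof. exact: Ck_onD. Qed.

Lemma Ck_sphereM k f g : Ck_sphere k f -> Ck_sphere k g ->
  Ck_sphere k (fun p => f p * g p).
Proof. exact: Ck_onM. Qed.

Lemma Ck_sphereN k f : Ck_sphere k f -> Ck_sphere k (fun p => - f p).
Proof. exact: Ck_onN. Qed.

Lemma Ck_sphereB k f g : Ck_sphere k f -> Ck_sphere k g ->
  Ck_sphere k (fun p => f p - g p).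
Proof. by move=> cf cg; apply: Ck_sphereD => //; exact: Ck_sphereN. Qed.

Lemma Ck_sphere_expR k f : Ck_sphere k f -> Ck_sphere k (fun p => expR (f p)).
Proof. exact: Ck_on_expR. Qed.

Lemma Ck_sphereS k f : Ck_sphere k.+1 f -> Ck_sphere k f.
Proof. exact: Ck_onS. Qed.

Lemma Ck_sphere1 k f : Ck_sphere k.+1 f -> Ck_sphere 1 f.
Proof. by elim: k => [//|k IH] cf; apply: IH; exact: Ck_sphereS. Qed.

Lemma Ck_sphere_coord k i : Ck_sphere k (fun p => p 0 i).
Proof.
apply: (@Ck_on_congr _ _ _ (fun x => (enorm x)^-1 * x 0 i)) => //.
  by move=> x _; rewrite /ext mxE.
by apply: Ck_onM => //; [exact: Ck_on_invenorm|exact: Ck_on_coord].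
Qed.

Lemma differentiable_ext f x : Ck_sphere 1 f -> x != 0 -> differentiable (ext f) x.
Proof. by move=> [df _] x0; exact: df. Qed.

(** The extension of [f] is homogeneous of degree 0, so its derivatives are
homogeneous of degree -1; extending them with degree 0 costs a factor [|x|]. *)
Lemma ext_dirder f v x : Ck_sphere 1 f -> x != 0 ->
  ext (fun p => dirder f p v) x = enorm x * 'D_v (ext f) x.
Proof.
move=> cf x0; have n0 := enorm_gt0 x0.
have sx := sphere_neq0 (sphere_normalize x0).
rewrite /ext -/(ext f) /dirder; set c := (enorm x)^-1.
have c0 : 0 < c by rewrite invr_gt0.
have dc : differentiable (ext f) (c *: x) by exact: differentiable_ext.
have -> : 'D_v (ext f) x = 'D_v (fun y => ext f (c *: y)) x.
  by under [in RHS]eq_fun do rewrite ext_scale//.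
rewrite [in RHS]deriveE; last exact: differentiable_comp.
rewrite (@diff_comp _ _ _ _ ( *:%R c) (ext f)) //= diff_val linearZ/= -deriveE//.
by rewrite /GRing.scale/= mulrA divff ?mul1r// gt_eqF.
Qed.

Lemma Ck_sphere_dirder k f v : Ck_sphere k.+1 f ->
  Ck_sphere k (fun p => dirder f p v).
Proof.
move=> cf; apply: (@Ck_on_congr _ _ _ (fun x => enorm x * 'D_v (ext f) x)) => //.
  move=> x x0; rewrite ext_dirder//; exact: Ck_sphere1 cf.
by apply: Ck_onM => //; [exact: Ck_on_enorm|exact: Ck_on_derive].
Qed.

Lemma Ck_sphere_diff f p : Ck_sphere 1 f -> sphere p -> differentiable (ext f) p.
Proof. by move=> cf sp; apply: differentiable_ext => //; exact: sphere_neq0. Qed.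

(** The factor [|x|] of [ext_dirder] is stationary in tangent directions, so
the symmetry of second derivatives in R^3 passes to the sphere, for constant
vectors [v] and [w] that are tangent at the point under consideration. *)
Lemma dirder_commute f p v w : Ck_sphere 2 f -> sphere p ->
  tangent p v -> tangent p w ->
  dirder (fun q => dirder f q v) p w = dirder (fun q => dirder f q w) p v.
Proof.
move=> cf sp tv tw; have p0 := sphere_neq0 sp.
suff H (a b : 'rV[R]_3) : tangent p b ->
    dirder (fun q => dirder f q a) p b = 'D_b (fun y => 'D_a (ext f) y) p.
  rewrite (H v w tw) (H w v tv); exact: derive_commute open_punctured cf p0.
move=> tb.
have -> : dirder (fun q => dirder f q a) p b =
          'D_b (fun x => enorm x * 'D_a (ext f) x) p.
  apply: near_eq_derive; near=> x; apply: ext_dirder; first exact: Ck_sphereS.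
  by near: x; exact: open_nbhs_nbhs.
have dn := @diff_derivable _ _ _ _ _ b (Ck_on_differentiable (Ck_on_enorm 1) p0).
have dd := @diff_derivable _ _ _ _ _ b (Ck_on_differentiable (Ck_on_derive (k := 1) a open_punctured cf) p0).
rewrite (deriveM dn dd).
by rewrite derive_enorm_tangent// enorm_sphere// scaler0 addr0 scale1r.
Unshelve. all: by end_near. Qed.

Lemma dirder_radial f p : Ck_sphere 1 f -> sphere p -> dirder f p p = 0.
Proof.
move=> cf sp; have df := Ck_sphere_diff cf sp.
have df0 : differentiable (ext f) (p + 0 *: p) by rewrite scale0r addr0.
have [_] := is_derive_line df0; rewrite scale0r addr0 /dirder => <-.
have N1 : \forall b \near (0 : R), -1 < b by apply: lt_nbhsr; rewrite ltrN10.
rewrite -[RHS](derive_cst (ext f p) (0 : R) 1); apply: near_eq_derive; near=> b.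
rewrite -[X in X + _]scale1r -scalerDl ext_scale//.
by rewrite -ltrBlDl sub0r; near: b.
Unshelve. all: by end_near. Qed.

Lemma dirder_basis f p v : Ck_sphere 1 f -> sphere p ->
  dirder f p v = v 0 0 * dirder f p (basis_vec R 0)
   + v 0 1 * dirder f p (basis_vec R 1) + v 0 2 * dirder f p (basis_vec R 2).
Proof.
by move=> cf sp; rewrite /dirder derive_basis ?sum3//; exact: Ck_sphere_diff.
Qed.

Lemma dirder_lin f p (a b : R) v w : Ck_sphere 1 f -> sphere p ->
  dirder f p (a *: v + b *: w) = a * dirder f p v + b * dirder f p w.
Proof.
move=> cf sp; have df := Ck_sphere_diff cf sp.
by rewrite /dirder !deriveE// linearD !linearZ.
Qed.

Lemma dirder_congr f g p v : (forall q, sphere q -> f q = g q) -> sphere p ->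
  dirder f p v = dirder g p v.
Proof.
move=> fg sp; apply: near_eq_derive; near=> x; apply: fg.
apply: sphere_normalize; near: x; apply: open_nbhs_nbhs; split=> //.
exact: sphere_neq0.
Unshelve. all: by end_near. Qed.

(** Carrying differentiability along with the value lets derivatives of
compound expressions be assembled from those of their parts, without side
conditions. *)
Definition sder p v f (l : R) := differentiable (ext f) p /\ dirder f p v = l.

Lemma sder_dirder p v f : Ck_sphere 1 f -> sphere p -> sder p v f (dirder f p v).
Proof. by move=> cf sp; split=> //; exact: Ck_sphere_diff. Qed.

Lemma sderE p v f l : sder p v f l -> dirder f p v = l.
Proof. by case. Qed.

Lemma sder_cst p v c : sder p v (fun=> c) 0.
Proof. by split; [exact: differentiable_cst|exact: derive_cst]. Qed.

Lemma sderD p v f g l m : sder p v f l -> sder p v g m ->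
  sder p v (fun q => f q + g q) (l + m).
Proof.
move=> [df fl] [dg gm]; split; first exact: differentiableD.
by rewrite -fl -gm /dirder -deriveD//; exact: diff_derivable.
Qed.

Lemma sderN p v f l : sder p v f l -> sder p v (fun q => - f q) (- l).
Proof.
move=> [df fl]; split; first exact: differentiableN.
by rewrite -fl /dirder -deriveN//; exact: diff_derivable.
Qed.

Lemma sderB p v f g l m : sder p v f l -> sder p v g m ->
  sder p v (fun q => f q - g q) (l - m).
Proof. by move=> fl gm; apply: sderD => //; exact: sderN. Qed.

Lemma sderM p v f g l m : sphere p -> sder p v f l -> sder p v g m ->
  sder p v (fun q => f q * g q) (f p * m + g p * l).
Proof.
move=> sp [df fl] [dg gm]; split; first exact: differentiableM.
rewrite -fl -gm /dirder -{1}(ext_sphere f sp) -{1}(ext_sphere g sp).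
by rewrite -deriveM//; exact: diff_derivable.
Qed.

Lemma sderZ p v f (c l : R) : sder p v f l -> sder p v (fun q => c * f q) (c * l).
Proof.
move=> [df fl]; split; first by apply: differentiableM => //; exact: differentiable_cst.
rewrite -fl /dirder -[RHS]/(c *: _) -deriveZ//; exact: diff_derivable.
Qed.

Lemma sder_expR p v f l : sphere p -> sder p v f l ->
  sder p v (fun q => expR (f q)) (expR (f p) * l).
Proof.
move=> sp [df fl]; have de := is_derive_expR (ext f p).
split; first exact: chain_differentiable df de.
by rewrite -fl /dirder -(ext_sphere f sp); exact: chain_derive.
Qed.

(** Tangency matters: off the tangent plane the derivative along [v] is that
along the tangential part of [v]. *)
Lemma sder_coord p v i : sphere p -> tangent p v -> sder p v (fun q => q 0 i) (v 0 i).
Proof.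
move=> sp tv; split; first exact: Ck_sphere_diff (Ck_sphere_coord 1 i) sp.
have p0 := sphere_neq0 sp.
rewrite /dirder (_ : ext _ = fun x => (enorm x)^-1 * x 0 i); last first.
  by apply/funext => x; rewrite /ext mxE.
have di := @diff_derivable _ _ _ _ _ v (Ck_on_differentiable (Ck_on_invenorm 1) p0).
have dc := @diff_derivable _ _ _ _ _ v (Ck_on_differentiable (Ck_on_coord punctured 1 i) p0).
rewrite (deriveM di dc).
rewrite derive_invenorm// derive_coord tv mul0r oppr0 scaler0 addr0.
by rewrite enorm_sphere// invr1 scale1r.
Qed.

End SphereCalculus.

(** * Exact 2-forms on a rectangle *)

Section Plane.
Variable R : realType.
Notation mu := (@lebesgue_measure R).
Implicit Types (F H Q : R -> R -> R).

Lemma integrable_continuous (a b : R) (f : R -> R) : continuous f ->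
  mu.-integrable `[a, b] (EFin \o f).
Proof.
move=> cf; apply: continuous_compact_integrable; first exact: segment_compact.
exact: continuous_subspaceT.
Qed.

Lemma Rintegral_segment_cst (a b c : R) : a <= b ->
  \int[mu]_(s in `[a, b]) c = c * (b - a).
Proof.
move=> ab; rewrite Rintegral_cst//= lebesgue_measure_itv/= lte_fin.
by case: ltgtP ab => //= -> _; rewrite subrr.
Qed.

(** Joint convergence at every point of a compact interval is uniform. Stating
it with a product filter lets the algebra of limits produce the hypothesis. *)
Lemma cvg_Rintegral (K : set_system R) (a b : R) (q : R -> R -> R) (q0 : R -> R) :
  Filter K -> a < b -> (forall k, continuous (q k)) -> continuous q0 ->
  (forall s0, q x.1 x.2 @[x --> filter_prod K (nbhs s0)] --> q0 s0) ->
  \int[mu]_(s in `[a, b]) q k s @[k --> K] --> \int[mu]_(s in `[a, b]) q0 s.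
Proof.
move=> FK ab cq cq0 qq0; apply/cvgrPdist_le => e e0.
pose e' := e / (b - a).
have e'0 : 0 < e' by rewrite divr_gt0// subr_gt0.
have unif : \forall k \near K, `[a, b]%classic `<=` (fun s => `|q0 s - q k s| <= e').
  have [cc _] := compact_near_coveringP (`[a, b]%classic : set R).
  apply: (cc (@segment_compact R a b) R K _ FK) => s0 _.
  have h1 : \forall s \near s0, `|q0 s0 - q0 s| < e' / 2.
    by have /cvgrPdist_lt := cq0 s0; apply; rewrite divr_gt0.
  have h2 : \forall x \near filter_prod K (nbhs s0), `|q0 s0 - q x.1 x.2| < e' / 2.
    by have /cvgrPdist_lt := qq0 s0; apply; rewrite divr_gt0.
  case: h2 => -[A B] /= [KA B0] AB.
  exists (B `&` [set s | `|q0 s0 - q0 s| < e' / 2], A); first by split=> //; exact: filterI.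
  move=> [s k] /= [[Bs hs] Ak].
  have := AB (k, s) (conj Ak Bs) => /= hk.
  rewrite -(subrKA (q0 s0)) (splitr e'); apply: le_trans (ler_normD _ _) _.
  by rewrite lerD// ltW// distrC.
move: unif; apply: filterS => k unif.
have cB : continuous (fun s => q0 s - q k s).
  by move=> s; apply: (@continuousB _ _ _ q0 (q k)); [exact: cq0|exact: cq].
rewrite -RintegralB//; [|exact: integrable_continuous..].
apply: (le_trans (le_normr_Rintegral _ _)) => //; first exact: integrable_continuous.
have -> : e = \int[mu]_(s in `[a, b]) e'.
  by rewrite Rintegral_segment_cst ?ltW// /e' divfK// gt_eqF// subr_gt0.
apply: le_Rintegral => //; apply: integrable_continuous; last exact: cst_continuous.
by move=> s; apply: cvg_norm; exact: cB.
Qed.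

Definition cont2 Q := continuous (fun x : R * R => Q x.1 x.2).

Lemma cont2_cvg (T : Type) (K : set_system T) (FK : Filter K) Q (f g : T -> R) a b :
  cont2 Q -> f @ K --> a -> g @ K --> b -> Q (f x) (g x) @[x --> K] --> Q a b.
Proof. by move=> cQ; apply: (@continuous2_cvg _ _ _ _ K _ f g Q a b); exact: cQ (a, b). Qed.

Lemma cont2_snd Q t : cont2 Q -> continuous (Q t).
Proof.
move=> cQ s; apply: (cont2_cvg _ cQ); [exact: cvg_cst|exact: cvg_id].
Qed.

Lemma cont2D Q Q' : cont2 Q -> cont2 Q' -> cont2 (fun t s => Q t s + Q' t s).
Proof. by move=> cQ cQ' x; exact: continuousD (cQ x) (cQ' x). Qed.

Lemma cont2B Q Q' : cont2 Q -> cont2 Q' -> cont2 (fun t s => Q t s - Q' t s).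
Proof. by move=> cQ cQ' x; exact: continuousB (cQ x) (cQ' x). Qed.

Lemma cont2M Q Q' : cont2 Q -> cont2 Q' -> cont2 (fun t s => Q t s * Q' t s).
Proof. by move=> cQ cQ' x; exact: continuousM (cQ x) (cQ' x). Qed.

Lemma continuous_inner (a b : R) Q : a < b -> cont2 Q ->
  continuous (fun t => \int[mu]_(s in `[a, b]) Q t s).
Proof.
move=> ab cQ t.
apply: (@cvg_Rintegral (nbhs t)) => // [k||s0]; [exact: cont2_snd|exact: cont2_snd|].
exact: cQ (t, s0).
Qed.

(** The partial derivatives are recorded as functions, so that their joint
continuity can be stated. *)
Definition C1plane F F1 F2 := [/\ cont2 F, cont2 F1, cont2 F2,
  forall t s : R, is_derive t 1 (F^~ s) (F1 t s) &
  forall t s : R, is_derive s 1 (F t) (F2 t s)].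

Lemma MVT_signed (f df : R -> R) (t h : R) :
  (forall a : R, is_derive a 1 f (df a)) ->
  exists2 c, `|c - t| <= `|h| & f (t + h) - f t = h * df c.
Proof.
move=> dP; have cf (i : interval R) : {within [set` i], continuous f}.
  by apply: derivable_within_continuous => a _; have [] := dP a.
have [h0|h0] := leP 0 h.
  have th : t <= t + h by rewrite lerDl.
  have [c] := MVT_segment th (fun a _ => dP a) (cf _).
  rewrite in_itv/= => /andP[c1 c2] ->; exists c; last by ring.
  by rewrite !ger0_norm ?subr_ge0//; lra.
have th : t + h <= t by rewrite gerDl ltW.
have [c] := MVT_segment th (fun a _ => dP a) (cf _).
rewrite in_itv/= => /andP[c1 c2] E; exists c.
  by rewrite (ltr0_norm h0) ler0_norm ?subr_le0//; lra.
by rewrite -opprB E; ring.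
Qed.

Lemma cvg_difference_quotient F F1 F2 t s0 : C1plane F F1 F2 ->
  x.1^-1 * (F (t + x.1) x.2 - F t x.2) @[x --> filter_prod 0^' (nbhs s0)]
  --> F1 t s0.
Proof.
move=> [cF cF1 _ dF _]; apply/cvgrPdist_lt => e e0.
have : \forall x \near (t, s0), `|F1 t s0 - F1 x.1 x.2| < e.
  by have /cvgrPdist_lt := cF1 (t, s0); exact.
move=> [[A B] /= [/nbhs_ballP[d /= d0 Ad] Bs] AB].
exists ([set h | h != 0 /\ `|h| < d], B).
  split=> //=; near=> h; split; first by near: h; exact: nbhs_dnbhs_neq.
  by near: h; exact: dnbhs0_lt.
move=> [h s] /= [[h0 hd] Bs'].
have [c ch ->] := MVT_signed t h (fun a => dF a s).
rewrite mulKf//; apply: (AB (c, s)); split=> //=; apply: Ad.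
by rewrite -ball_normE/= distrC; exact: le_lt_trans hd.
Unshelve. all: by end_near. Qed.

Lemma cvg_is_derive (f : R -> R) (t l : R) :
  h^-1 * (f (t + h) - f t) @[h --> 0^'] --> l -> is_derive t 1 f l.
Proof.
move=> fl.
have E : (fun h : R => h^-1 *: ((f \o shift t) (h *: 1) - f t)) =
         (fun h => h^-1 * (f (t + h) - f t)).
  by apply/funext => h /=; rewrite /GRing.scale/= mulr1 [t + h]addrC.
by apply: DeriveDef; rewrite /derivable /derive E; [apply/cvg_ex; exists l|exact/cvg_lim].
Qed.

Lemma Rintegral_by_parts_periodic (a b : R) (f g df dg : R -> R) : a < b ->
  (forall s : R, is_derive s 1 f (df s)) -> (forall s : R, is_derive s 1 g (dg s)) ->
  continuous df -> continuous dg -> f b * g b = f a * g a ->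
  \int[mu]_(s in `[a, b]) (f s * dg s) = - \int[mu]_(s in `[a, b]) (df s * g s).
Proof.
move=> ab dF dG cdf cdg per.
have LR (h dh : R -> R) : (forall s : R, is_derive s 1 h (dh s)) ->
    derivable_oo_LRcontinuous h a b.
  move=> dH; have ch : continuous h.
    move=> x; apply: differentiable_continuous; apply/derivable1_diffP.
    by have [] := dH x.
  split; first by move=> x _; have [] := dH x.
    by apply: cvg_at_right_filter; exact: ch.
  by apply: cvg_at_left_filter; exact: ch.
rewrite (@Rintegration_by_parts _ f g df dg)//.
- by rewrite per subrr sub0r.
- exact: continuous_subspaceT.
- exact: LR dF.
- by move=> s _; rewrite derive1E; have [_ ->] := dF s.
- exact: continuous_subspaceT.
- exact: LR dG.
- by move=> s _; rewrite derive1E; have [_ ->] := dG s.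
Qed.

(** Formally the derivative of the integral of [F dH/ds] contains the mixed
derivative of [H], which does not exist here. In the difference quotient the
increment of [dH/ds] is integrated by parts in [s] before the limit is taken,
so that first derivatives suffice. *)
Lemma is_derive_boundary_term (b : R) F F1 F2 H H1 H2 (t : R) : 0 < b ->
  C1plane F F1 F2 -> C1plane H H1 H2 ->
  (forall t, F t b = F t 0) -> (forall t, H t b = H t 0) ->
  is_derive t 1 (fun t => \int[mu]_(s in `[0, b]) (F t s * H2 t s))
    (\int[mu]_(s in `[0, b]) (F1 t s * H2 t s - F2 t s * H1 t s)).
Proof.
move=> b0 CF CH pF pH; apply: cvg_is_derive.
have [cF cF1 cF2 dF1 dF2] := CF; have [cH cH1 cH2 dH1 dH2] := CH.
(* The difference quotient, after integration by parts of its second half. *)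
pose q (h s : R) := h^-1 * (F (t + h) s - F t s) * H2 (t + h) s
  - F2 t s * (h^-1 * (H (t + h) s - H t s)).
have cc (f g : R -> R) : continuous f -> continuous g -> continuous (fun s => f s * g s).
  by move=> cf cg x; exact: continuousM (cf x) (cg x).
have cB (f g : R -> R) : continuous f -> continuous g -> continuous (fun s => f s - g s).
  by move=> cf cg x; exact: continuousB (cf x) (cg x).
have cst (c : R) : continuous (fun _ : R => c) by exact: cst_continuous.
have c0 (Q : R -> R -> R) k : cont2 Q -> continuous (Q k) by exact: cont2_snd.
have E : (fun h => h^-1 * (\int[mu]_(s in `[0, b]) (F (t + h) s * H2 (t + h) s) -
     \int[mu]_(s in `[0, b]) (F t s * H2 t s))) =
     (fun h => \int[mu]_(s in `[0, b]) q h s).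
  apply/funext => h.
  have i1 : mu.-integrable `[0, b] (EFin \o (fun s => (F (t + h) s - F t s) * H2 (t + h) s)).
    by apply: integrable_continuous; apply: (cc); [apply: (cB)|]; exact: c0.
  have i2 : mu.-integrable `[0, b] (EFin \o (fun s => F2 t s * (H (t + h) s - H t s))).
    by apply: integrable_continuous; apply: (cc); [|apply: (cB)]; exact: c0.
  have i3 : mu.-integrable `[0, b] (EFin \o (fun s => F t s * (H2 (t + h) s - H2 t s))).
    by apply: integrable_continuous; apply: (cc); [|apply: (cB)]; exact: c0.
  transitivity (h^-1 * (\int[mu]_(s in `[0, b]) ((F (t + h) s - F t s) * H2 (t + h) s)
     + \int[mu]_(s in `[0, b]) (F t s * (H2 (t + h) s - H2 t s)))).
    congr (_ * _); rewrite -RintegralB//; [|apply: integrable_continuous; apply: (cc); exact: c0..].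
    rewrite -RintegralD//; apply: eq_Rintegral => s _; ring.
  rewrite (@Rintegral_by_parts_periodic 0 b (F t) (fun s => H (t + h) s - H t s)
    (F2 t) (fun s => H2 (t + h) s - H2 t s))//.
  - rewrite -RintegralB// -RintegralZl//; last first.
      by apply: integrable_continuous; apply: (cB); apply: (cc); (try apply: (cB)); exact: c0.
    by apply: eq_Rintegral => s _; rewrite /q; ring.
  - exact: c0.
  - by apply: (cB); exact: c0.
  - by rewrite pF !pH.
rewrite E; apply: cvg_Rintegral => // [h||s0].
- by rewrite /q; apply: (cB); apply: (cc); (try apply: (cc)); (try apply: (cB)); (try exact: cst); exact: c0.
- by apply: (cB); apply: (cc); exact: c0.
have shift (Q : R -> R -> R) : cont2 Q ->
    Q (t + x.1) x.2 @[x --> filter_prod 0^' (nbhs s0)] --> Q t s0.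
  move=> cQ; apply: (cont2_cvg _ cQ); last exact: cvg_snd.
  rewrite -[X in _ --> X]addr0; apply: cvgD; first exact: cvg_cst.
  apply: (cvg_trans cvg_fst); exact: cvg_within.
have const (Q : R -> R -> R) : cont2 Q ->
    Q t x.2 @[x --> filter_prod 0^' (nbhs s0)] --> Q t s0.
  by move=> cQ; apply: (cont2_cvg _ cQ); [exact: cvg_cst|exact: cvg_snd].
apply: cvgB; apply: cvgM.
- exact: cvg_difference_quotient CF.
- exact: shift.
- exact: const.
- exact: cvg_difference_quotient CH.
Qed.

Lemma Rintegral_derive (a b : R) (f df : R -> R) : a < b ->
  (forall t : R, is_derive t 1 f (df t)) -> continuous df ->
  \int[mu]_(t in `[a, b]) df t = f b - f a.
Proof.
move=> ab dF cdf.
have cf : continuous f.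
  move=> x; apply: differentiable_continuous; apply/derivable1_diffP.
  by have [] := dF x.
rewrite /Rintegral (@continuous_FTC2 _ df f)//.
- exact: continuous_subspaceT.
- split; first by move=> x _; have [] := dF x.
    by apply: cvg_at_right_filter; exact: cf.
  by apply: cvg_at_left_filter; exact: cf.
- by move=> s _; rewrite derive1E; have [_ ->] := dF s.
Qed.

(** This is Stokes for [dF /\ dH = d(F dH)] on a rectangle. Periodicity removes
the sides [s = 0] and [s = b]; on the other two sides [H] does not depend on
[s], as befits the poles of a sphere. *)
Lemma Rintegral_wedge (a b : R) F F1 F2 H H1 H2 : 0 < a -> 0 < b ->
  C1plane F F1 F2 -> C1plane H H1 H2 ->
  (forall t, F t b = F t 0) -> (forall t, H t b = H t 0) ->
  (forall s, H2 0 s = 0) -> (forall s, H2 a s = 0) ->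
  \int[mu]_(t in `[0, a]) \int[mu]_(s in `[0, b])
    (F1 t s * H2 t s - F2 t s * H1 t s) = 0.
Proof.
move=> a0 b0 CF CH pF pH H20 H2a.
have [cF cF1 cF2 dF1 dF2] := CF; have [cH cH1 cH2 dH1 dH2] := CH.
rewrite (Rintegral_derive a0 (fun t => is_derive_boundary_term t b0 CF CH pF pH)).
  under eq_Rintegral do rewrite H2a mulr0.
  under [X in _ - X]eq_Rintegral do rewrite H20 mulr0.
  by rewrite subrr.
apply: continuous_inner => //.
by apply: cont2B; exact: cont2M.
Qed.

(** The primitive of a nonnegative function grows from 0 to the total integral
0, so it is constant, and its derivative is the function. *)
Lemma Rintegral_eq0_continuous (a b : R) (f : R -> R) : a < b -> continuous f ->
  (forall t, a <= t <= b -> 0 <= f t) -> \int[mu]_(t in `[a, b]) f t = 0 ->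
  forall t, a < t < b -> f t = 0.
Proof.
move=> ab cf f0 If0.
have int c d := integrable_continuous c d cf.
pose Phi x := \int[mu]_(t in `[a, x]) f t.
have Phi0 x : a < x < b -> Phi x = 0.
  move=> /andP[ax xb]; apply/eqP; rewrite eq_le; apply/andP; split; last first.
    rewrite /Phi; apply: Rintegral_ge0 => t/=; rewrite in_itv/= => /andP[at_ tx].
    by apply: f0; rewrite at_/= (le_trans tx)// ltW.
  rewrite -If0 -subr_ge0.
  rewrite (@Rintegral_itvB _ f (BLeft a) (BRight b) x)//; [|by rewrite bnd_simp ltW..].
  apply: Rintegral_ge0 => t/=; rewrite in_itv/= => /andP[xt tb].
  by apply: f0; rewrite tb (le_trans (ltW ax) (ltW xt)).
move=> t tab; have /andP[at_ tb] := tab.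
have [_ <-] := continuous_FTC1_closed tb (int a b) at_ (cf t).
rewrite derive1E -[RHS](derive_cst (0 : R) t 1); apply: near_eq_derive.
near=> x; apply: Phi0; apply/andP; split; near: x; [exact: lt_nbhsr|exact: lt_nbhsl].
Unshelve. all: by end_near. Qed.

End Plane.

(** * Spherical coordinates and Stokes' theorem on the sphere *)

Section Frame.
Variable R : realType.
Implicit Types (f g h : 'rV[R]_3 -> R) (p v w : 'rV[R]_3).

Definition row3 (a b c : R) : 'rV[R]_3 := \row_(i < 3) [:: a; b; c]`_i.

Lemma row3_0 (a b c : R) : row3 a b c 0 0 = a. Proof. by rewrite mxE. Qed.
Lemma row3_1 (a b c : R) : row3 a b c 0 1 = b. Proof. by rewrite mxE. Qed.
Lemma row3_2 (a b c : R) : row3 a b c 0 2 = c. Proof. by rewrite mxE. Qed.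
Definition row3E := (row3_0, row3_1, row3_2).

Definition cross v w : 'rV[R]_3 := row3
  (v 0 1 * w 0 2 - v 0 2 * w 0 1) (v 0 2 * w 0 0 - v 0 0 * w 0 2)
  (v 0 0 * w 0 1 - v 0 1 * w 0 0).

Notation sph := (@spherical R).
(** With [azimuthal], a frame that extends smoothly over the whole coordinate
rectangle, although at the poles it depends on the meridian. *)
Definition polar (t s : R) := row3 (cos t * cos s) (cos t * sin s) (- sin t).
Definition azimuthal (t s : R) := row3 (- sin s) (cos s) 0.

Lemma sphE t s : sph t s = row3 (sin t * cos s) (sin t * sin s) (cos t).
Proof. by []. Qed.

Lemma sphere_sph t s : sphere (sph t s).
Proof.
rewrite /sphere/= dotE sphE !row3E.
transitivity (sin t ^+ 2 * (cos s ^+ 2 + sin s ^+ 2) + cos t ^+ 2); first by ring.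
by rewrite cos2Dsin2 mulr1 addrC cos2Dsin2.
Qed.

(** The cross products are part of the definition to fix the orientation. *)
Definition frame p v w :=
  [/\ dot p p = 1, dot v v = 1, dot w w = 1, dot p v = 0 & dot p w = 0] /\
  [/\ dot v w = 0, cross v w = p, cross w p = v & cross p v = w].

Lemma frame_sph t s : frame (sph t s) (polar t s) (azimuthal t s).
Proof.
have ct := cos2Dsin2 t; have cs := cos2Dsin2 s.
split; split.
- exact: sphere_sph.
- rewrite dotE !row3E.
  transitivity (cos t ^+ 2 * (cos s ^+ 2 + sin s ^+ 2) + sin t ^+ 2); first by ring.
  by rewrite cs mulr1.
- rewrite dotE !row3E -cs; ring.
- rewrite sphE dotE !row3E.
  transitivity (sin t * cos t * (cos s ^+ 2 + sin s ^+ 2) - sin t * cos t); first by ring.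
  by rewrite cs; ring.
- rewrite sphE dotE !row3E; ring.
- rewrite dotE !row3E; ring.
- apply/rowP; apply: ord3P; rewrite sphE /cross !row3E; [ring|ring|].
  transitivity (cos t * (cos s ^+ 2 + sin s ^+ 2)); first by ring.
  by rewrite cs mulr1.
- apply/rowP; apply: ord3P; rewrite sphE /cross !row3E; [ring|ring|].
  transitivity (- (sin t * (cos s ^+ 2 + sin s ^+ 2))); first by ring.
  by rewrite cs mulr1.
- apply/rowP; apply: ord3P; rewrite sphE /cross !row3E; [| |ring].
    transitivity (- (sin s * (cos t ^+ 2 + sin t ^+ 2))); first by ring.
    by rewrite ct mulr1.
  transitivity (cos s * (cos t ^+ 2 + sin t ^+ 2)); first by ring.
  by rewrite ct mulr1.
Qed.

Lemma sph_surjective p : sphere p -> exists t s : R, p = sph t s.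
Proof.
move=> sp; have E : p 0 0 ^+ 2 + p 0 1 ^+ 2 + p 0 2 ^+ 2 = 1.
  by move: sp; rewrite /sphere/= dotE -!expr2.
have h0 := sqr_ge0 (p 0 0); have h1 := sqr_ge0 (p 0 1); have h2 := sqr_ge0 (p 0 2).
have z1 : -1 <= p 0 2 <= 1.
  by apply/andP; split; nra.
pose t := acos (p 0 2).
have ct : cos t = p 0 2 by rewrite acosK.
have /andP[t0 tpi] : 0 <= t <= pi by rewrite acos_ge0// acos_lepi.
have st : 0 <= sin t by apply: sin_ge0_pi; rewrite t0.
have E2 : sin t ^+ 2 = p 0 0 ^+ 2 + p 0 1 ^+ 2.
  by rewrite sin2cos2 ct; lra.
have [st0|stn0] := eqVneq (sin t) 0.
  exists t, 0; apply/rowP; rewrite sphE.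
  move: E2; rewrite st0 expr0n/= => E2.
  have [e0 e1] : p 0 0 ^+ 2 = 0 /\ p 0 1 ^+ 2 = 0 by split; lra.
  apply: ord3P; rewrite !row3E ?mul0r//; apply/eqP; rewrite -sqrf_eq0; exact/eqP.
pose x := p 0 0 / sin t; pose y := p 0 1 / sin t.
have xy : x ^+ 2 + y ^+ 2 = 1.
  by rewrite /x /y !exprMn -mulrDl -E2 exprVn divff// sqrf_eq0.
have x1 : -1 <= x <= 1.
  by have := sqr_ge0 y => y2; apply/andP; split; nra.
have cx : cos (acos x) = x by rewrite acosK.
have sx : 0 <= sin (acos x) by apply: sin_ge0_pi; rewrite acos_ge0// acos_lepi.
have sx2 : sin (acos x) ^+ 2 = y ^+ 2 by rewrite sin2cos2 cx; lra.
have px : p 0 0 = sin t * x by rewrite /x mulrC divfK.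
have py : p 0 1 = sin t * y by rewrite /y mulrC divfK.
(* The inverse cosine has nonnegative sine; the other half circle needs - s. *)
have [y0|y0] := leP 0 y.
  exists t, (acos x); apply/rowP; rewrite sphE; apply: ord3P; rewrite !row3E ?cx//.
  by rewrite py; congr (_ * _); apply/eqP; rewrite -(eqrXn2 (n := 2))// sx2.
exists t, (- acos x); apply/rowP; rewrite sphE; apply: ord3P; rewrite !row3E ?cosN ?cx//.
rewrite sinN py; congr (_ * _); apply/eqP; rewrite -eqr_oppLR -(eqrXn2 (n := 2))// ?sx2 ?sqrrN//.
by rewrite oppr_ge0 ltW.
Qed.

Lemma cvg_row3 (T : Type) (K : set_system T) (FK : Filter K) (F : T -> 'rV[R]_3) v :
  (forall i, F x 0 i @[x --> K] --> v 0 i) -> F @ K --> v.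
Proof.
move=> Fv A [P /= vP PA].
have : \forall x \near K, forall i, P 0 i (F x 0 i).
  by apply: filter_forall => i; apply: Fv; exact: vP.
apply: filterS => x Px; apply: PA => i j; rewrite (ord1 i); exact: Px.
Qed.

Lemma cont2_fun1 (f : R -> R) : continuous f -> cont2 (fun t _ => f t).
Proof. by move=> cf x; apply: (@cvg_comp _ _ _ fst f _ (nbhs x.1)); [exact: cvg_fst|exact: cf]. Qed.

Lemma cont2_fun2 (f : R -> R) : continuous f -> cont2 (fun _ s => f s).
Proof. by move=> cf x; apply: (@cvg_comp _ _ _ snd f _ (nbhs x.2)); [exact: cvg_snd|exact: cf]. Qed.

Lemma cont2_sph i : cont2 (fun t s => sph t s 0 i).
Proof.
have cs := cont2_fun2 (@continuous_cos R); have ss := cont2_fun2 (@continuous_sin R).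
have ct := cont2_fun1 (@continuous_cos R); have st := cont2_fun1 (@continuous_sin R).
move: i; apply: ord3P; rewrite /cont2; under eq_fun do rewrite sphE !row3E.
- exact: cont2M st cs.
- exact: cont2M st ss.
- exact: ct.
Qed.

Lemma cont2_comp_sph f : Ck_sphere 0 f -> cont2 (fun t s => f (sph t s)).
Proof.
move=> cf [t s]; have sp := sphere_sph t s.
have E : (fun x : R * R => f (sph x.1 x.2)) = (fun x => ext f (sph x.1 x.2)).
  by apply/funext => x; rewrite ext_sphere//; exact: sphere_sph.
rewrite E; apply: (@continuous_comp _ _ _ (fun x : R * R => sph x.1 x.2) (ext f)).
  by apply: cvg_row3 => i; exact: cont2_sph.
exact: cf (sphere_neq0 sp).
Qed.

Lemma is_derive_row3 (a b c da db dc : R -> R) (t : R) :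
  is_derive t 1 a (da t) -> is_derive t 1 b (db t) -> is_derive t 1 c (dc t) ->
  is_derive t 1 (fun t => row3 (a t) (b t) (c t)) (row3 (da t) (db t) (dc t)).
Proof.
move=> [a1 a2] [b1 b2] [c1 c2].
have e0 : (fun t => row3 (a t) (b t) (c t) 0 0) = a by apply/funext => x; rewrite row3E.
have e1 : (fun t => row3 (a t) (b t) (c t) 0 1) = b by apply/funext => x; rewrite row3E.
have e2 : (fun t => row3 (a t) (b t) (c t) 0 2) = c by apply/funext => x; rewrite row3E.
have D0 := eq_ind_r (fun F : R -> R => derivable F t 1) a1 e0.
have D1 := eq_ind_r (fun F : R -> R => derivable F t 1) b1 e1.
have D2 := eq_ind_r (fun F : R -> R => derivable F t 1) c1 e2.
have D i j : derivable (fun t : R => row3 (a t) (b t) (c t) i j) t 1.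
  by rewrite (ord1 i); move: j; apply: ord3P; [exact: D0|exact: D1|exact: D2].
have dr : derivable (fun t : R => row3 (a t) (b t) (c t)) t 1 by exact/derivable_mxP.
apply: DeriveDef => //; rewrite derive_mx//; apply/matrixP => i j; rewrite mxE (ord1 i).
move: j; apply: ord3P.
- by rewrite e0 a2 row3E.
- by rewrite e1 b2 row3E.
- by rewrite e2 c2 row3E.
Qed.

Lemma is_derive_curve f (c : R -> 'rV[R]_3) (t : R) dc : differentiable f (c t) ->
  is_derive t 1 c dc -> is_derive t 1 (fun t => f (c t)) ('D_dc f (c t)).
Proof.
move=> df [dcx <-].
have dct : differentiable c t by exact/derivable1_diffP.
have dd : differentiable (f \o c) t by exact: differentiable_comp.
apply: DeriveDef; first exact: (diff_derivable (f := f \o c)).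
by rewrite (deriveE _ dd) (deriveE _ dct) (deriveE _ df) diff_comp.
Qed.

(** The factor [sin t] is the length of the coordinate field along parallels.
*)
Lemma C1plane_sph f : Ck_sphere 1 f -> C1plane (fun t s => f (sph t s))
  (fun t s => dirder f (sph t s) (polar t s))
  (fun t s => sin t * dirder f (sph t s) (azimuthal t s)).
Proof.
move=> cf.
have cs := cont2_fun2 (@continuous_cos R); have ss := cont2_fun2 (@continuous_sin R).
have ct := cont2_fun1 (@continuous_cos R); have st := cont2_fun1 (@continuous_sin R).
have cd v : cont2 (fun t s => dirder f (sph t s) v).
  by apply: (@cont2_comp_sph (fun p => dirder f p v)); exact: Ck_sphere_dirder cf.
have cN Q : cont2 Q -> cont2 (fun t s => - Q t s).
  by move=> cQ x; exact: continuousN (cQ x).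
have cd3 (a b c : R -> R -> R) : cont2 a -> cont2 b -> cont2 c ->
    cont2 (fun t s => dirder f (sph t s) (row3 (a t s) (b t s) (c t s))).
  move=> ca cb cc.
  have -> : (fun t s => dirder f (sph t s) (row3 (a t s) (b t s) (c t s))) =
   (fun t s => a t s * dirder f (sph t s) (basis_vec R 0) +
     b t s * dirder f (sph t s) (basis_vec R 1) + c t s * dirder f (sph t s) (basis_vec R 2)).
    apply/funext => t; apply/funext => s; rewrite (dirder_basis _ cf (sphere_sph t s)).
    by rewrite !row3E.
  by apply: cont2D; [apply: cont2D|]; apply: cont2M.
split.
- exact: cont2_comp_sph (Ck_sphereS cf).
- by apply: cd3; [exact: cont2M|exact: cont2M|exact: cN].
- apply: cont2M => //; apply: cd3 => //; [exact: cN|].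
  by move=> x; exact: cst_continuous.
- move=> t s; have sp := sphere_sph t s.
  have -> : (fun t => f (sph t s)) = (fun t => ext f (sph t s)).
    by apply/funext => x; rewrite ext_sphere//; exact: sphere_sph.
  apply: is_derive_curve; first exact: Ck_sphere_diff.
  apply: (@is_derive_row3 (fun t => sin t * cos s) (fun t => sin t * sin s) cos
    (fun t => cos t * cos s) (fun t => cos t * sin s) (fun t => - sin t)).
  + by apply: is_derive_eq; rewrite /GRing.scale/= mulr0 add0r mulrC.
  + by apply: is_derive_eq; rewrite /GRing.scale/= mulr0 add0r mulrC.
- move=> t s; have sp := sphere_sph t s; change (is_derive s 1 (fun s => f (sph t s))
    (sin t * dirder f (sph t s) (azimuthal t s))).
  have -> : (fun s => f (sph t s)) = (fun s => ext f (sph t s)).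
    by apply/funext => x; rewrite ext_sphere//; exact: sphere_sph.
  have -> : sin t * dirder f (sph t s) (azimuthal t s) = 
     'D_(row3 (sin t * - sin s) (sin t * cos s) 0) (ext f) (sph t s).
    have -> : row3 (sin t * - sin s) (sin t * cos s) 0 = sin t *: azimuthal t s + 0 *: 0.
      by apply/rowP; apply: ord3P; rewrite scaler0 addr0 !mxE/= ?mulr0.
    by rewrite -[RHS]/(dirder _ _ _) (dirder_lin _ _ _ _ cf sp) mul0r addr0.
  apply: is_derive_curve; first exact: Ck_sphere_diff.
  apply: (@is_derive_row3 (fun s => sin t * cos s) (fun s => sin t * sin s) (fun=> cos t)
    (fun s => sin t * - sin s) (fun s => sin t * cos s) (fun=> 0)).
Qed.

(** The density of [df /\ dh] against the area form of the sphere. *)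
Definition jac f h (t s : R) :=
  dirder f (sph t s) (polar t s) * dirder h (sph t s) (azimuthal t s) -
  dirder f (sph t s) (azimuthal t s) * dirder h (sph t s) (polar t s).

Definition integral2 (Q : R -> R -> R) : R :=
  \int[@lebesgue_measure R]_(t in `[0, pi])
    \int[@lebesgue_measure R]_(s in `[0, 2 * pi]) Q t s.

Lemma jacE f h t s : jac f h t s * sin t =
  dirder f (sph t s) (polar t s) * (sin t * dirder h (sph t s) (azimuthal t s)) -
  (sin t * dirder f (sph t s) (azimuthal t s)) * dirder h (sph t s) (polar t s).
Proof.
have E (x y z u r : R) : (x * y - z * u) * r = x * (r * y) - (r * z) * u by ring.
exact: E.
Qed.

Lemma cont2_jac f h : Ck_sphere 1 f -> Ck_sphere 1 h ->
  cont2 (fun t s => jac f h t s * sin t).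
Proof.
move=> /C1plane_sph[_ cf1 cf2 _ _] /C1plane_sph[_ ch1 ch2 _ _].
rewrite (_ : (fun _ => _) = (fun t s =>
  dirder f (sph t s) (polar t s) * (sin t * dirder h (sph t s) (azimuthal t s)) -
  (sin t * dirder f (sph t s) (azimuthal t s)) * dirder h (sph t s) (polar t s))).
  by apply: cont2B; exact: cont2M.
by apply/funext => t; apply/funext => s; exact: jacE.
Qed.

Lemma two_pi_gt0 : 0 < 2 * pi :> R.
Proof. by rewrite mulr_gt0// pi_gt0. Qed.

(** In coordinates [df /\ dh] is exact on the rectangle, and the boundary terms
at the poles vanish because parallels shrink to points there. *)
Lemma integral2_jac f h : Ck_sphere 1 f -> Ck_sphere 1 h ->
  integral2 (fun t s => jac f h t s * sin t) = 0.
Proof.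
move=> cf ch.
have per f' t : f' (sph t (2 * pi)) = f' (sph t 0) :> R.
  by rewrite !sphE mulr_natl cos2pi sin2pi cos0 sin0.
rewrite -[RHS](Rintegral_wedge (pi_gt0 R) two_pi_gt0 (C1plane_sph cf) (C1plane_sph ch))//.
- by apply: eq_Rintegral => t _; apply: eq_Rintegral => s _; exact: jacE.
- by move=> s; rewrite sin0 mul0r.
- by move=> s; rewrite sinpi mul0r.
Qed.

Lemma integral2D Q Q' : cont2 Q -> cont2 Q' ->
  integral2 (fun t s => Q t s + Q' t s) = integral2 Q + integral2 Q'.
Proof.
move=> cQ cQ'; rewrite /integral2 -RintegralD//; last 2 first.
- by apply: integrable_continuous; apply: continuous_inner => //; exact: two_pi_gt0.
- by apply: integrable_continuous; apply: continuous_inner => //; exact: two_pi_gt0.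
apply: eq_Rintegral => t _; rewrite RintegralD//; apply: integrable_continuous; exact: cont2_snd.
Qed.

Lemma integral2Z (c : R) Q : cont2 Q ->
  integral2 (fun t s => c * Q t s) = c * integral2 Q.
Proof.
move=> cQ; rewrite /integral2 -RintegralZl//; last first.
  by apply: integrable_continuous; apply: continuous_inner => //; exact: two_pi_gt0.
apply: eq_Rintegral => t _; rewrite RintegralZl//; apply: integrable_continuous; exact: cont2_snd.
Qed.

(** Densities, against the area form, of 2-forms of integral 0. Continuity is
included so that they can be added. *)
Definition null_form Q := cont2 (fun t s => Q t s * sin t) /\
  integral2 (fun t s => Q t s * sin t) = 0.

Lemma null_jac f h : Ck_sphere 1 f -> Ck_sphere 1 h -> null_form (jac f h).
Proof. by move=> cf ch; split; [exact: cont2_jac|exact: integral2_jac]. Qed.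

Lemma null_formD Q Q' : null_form Q -> null_form Q' ->
  null_form (fun t s => Q t s + Q' t s).
Proof.
move=> [cQ IQ] [cQ' IQ'].
rewrite /null_form (_ : (fun t s => (Q t s + Q' t s) * sin t) =
  (fun t s => Q t s * sin t + Q' t s * sin t)).
  by split; [exact: cont2D|rewrite integral2D// IQ IQ' addr0].
by apply/funext => t; apply/funext => s; rewrite mulrDl.
Qed.

Lemma null_formZ (c : R) Q : null_form Q -> null_form (fun t s => c * Q t s).
Proof.
move=> [cQ IQ].
rewrite /null_form (_ : (fun t s => (c * Q t s) * sin t) =
  (fun t s => c * (Q t s * sin t))).
  split; last by rewrite integral2Z// IQ mulr0.
  by apply: cont2M => // x; exact: cst_continuous.
by apply/funext => t; apply/funext => s; rewrite mulrA.
Qed.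

Lemma integral2_eq0 Q : cont2 Q -> (forall t s, 0 <= t <= pi -> 0 <= Q t s) ->
  integral2 Q = 0 -> forall t s, 0 < t < pi -> 0 < s < 2 * pi -> Q t s = 0.
Proof.
move=> cQ Q0 IQ t s tI sI.
apply: (Rintegral_eq0_continuous two_pi_gt0 (cont2_snd (t := t) cQ)) => //.
  by move=> s' _; apply: Q0; move/andP: tI => [? ?]; rewrite !ltW.
apply: (Rintegral_eq0_continuous (pi_gt0 R) (continuous_inner two_pi_gt0 cQ)) => //.
by move=> t' t'I; apply: Rintegral_ge0 => s' _; exact: Q0.
Qed.

End Frame.

(** * The differential system of a conformal Killing field *)

Section ConformalKilling.
Variable R : realType.
Implicit Types (f g h : 'rV[R]_3 -> R) (p v w : 'rV[R]_3) (Y Z : 'rV[R]_3 -> 'rV[R]_3).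
Notation sph := (@spherical R).

Lemma vec3P v w : v 0 0 = w 0 0 -> v 0 1 = w 0 1 -> v 0 2 = w 0 2 -> v = w.
Proof. by move=> *; apply/rowP; exact: ord3P. Qed.

(** The matrix with rows [p], [e1], [e2] is orthogonal, so its transpose is
also a right inverse. *)
Lemma frame_decomposition p e1 e2 v : frame p e1 e2 ->
  v = dot v e1 *: e1 + dot v e2 *: e2 + dot v p *: p.
Proof.
move=> [[pp p1 p2 pe1 pe2] [e12 _ _ _]].
pose M : 'M[R]_3 := \matrix_(i < 3) [:: p; e1; e2]`_i.
have M0 : row 0 M = p by rewrite rowK.
have M1 : row 1 M = e1 by rewrite rowK.
have M2 : row 2 M = e2 by rewrite rowK.
have [e1p e2p e21] : [/\ dot e1 p = 0, dot e2 p = 0 & dot e2 e1 = 0].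
  by split; rewrite dotC.
have MMT : M *m M^T = 1%:M.
  have E i j : (M *m M^T) i j = dot (row i M) (row j M).
    by rewrite mxE; apply: eq_bigr => k _; rewrite !mxE.
  apply/matrixP => i j; rewrite E mxE; move: i; apply: ord3P; move: j; apply: ord3P;
    by rewrite ?M0 ?M1 ?M2 ?pp ?p1 ?p2 ?pe1 ?pe2 ?e12 ?e1p ?e2p ?e21.
have := mulmx1C MMT => MTM.
have : v *m (M^T *m M) = v by rewrite MTM mulmx1.
rewrite mulmxA => E; rewrite -{1}E mulmx_sum_row sum3 M0 M1 M2.
have vM i : (v *m M^T) 0 i = dot v (row i M).
  by rewrite mxE; apply: eq_bigr => k _; rewrite !mxE.
by rewrite !vM M0 M1 M2 -addrA addrC.
Qed.

Lemma dot_cross v w z : dot (cross v w) z = dot v (cross w z).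
Proof. by rewrite !dotE /cross !row3E; ring. Qed.

Lemma cross_anti v w : cross v w = - cross w v.
Proof. by apply: vec3P; rewrite [in RHS]mxE /cross !row3E; ring. Qed.

Lemma dot0l v : dot 0 v = 0.
Proof. by rewrite dotE !mxE !mul0r !addr0. Qed.

Lemma dotNl v w : dot (- v) w = - dot v w.
Proof. by rewrite -scaleN1r dotZl mulN1r. Qed.

Lemma dotDr v w z : dot v (w + z) = dot v w + dot v z.
Proof. by rewrite dotC dotDl !(dotC _ v). Qed.

Lemma dotZr (c : R) v w : dot v (c *: w) = c * dot v w.
Proof. by rewrite dotC dotZl dotC. Qed.

Lemma dotNr v w : dot v (- w) = - dot v w.
Proof. by rewrite dotC dotNl dotC. Qed.

Lemma crossvv v : cross v v = 0.
Proof. by apply: vec3P; rewrite [RHS]mxE /cross !row3E; ring. Qed.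

Lemma crossDl v w z : cross (v + w) z = cross v z + cross w z.
Proof. by apply: vec3P; rewrite [RHS]mxE /cross !row3E !mxE; ring. Qed.

Lemma crossZl (c : R) v z : cross (c *: v) z = c *: cross v z.
Proof. by apply: vec3P; rewrite [RHS]mxE /cross !row3E !mxE; ring. Qed.

(** Derivative in R^3 of a vector field along the sphere; its tangential part
is the covariant derivative. *)
Definition dvec Y p v : 'rV[R]_3 := \row_(i < 3) dirder (fun q => Y q 0 i) p v.

Definition Ck_vec k Y := forall i, Ck_sphere k (fun q => Y q 0 i).

Local Opaque dot dirder.

Definition svder p v Y (L : 'rV[R]_3) := forall i, sder p v (fun q => Y q 0 i) (L 0 i).

Lemma svder_dvec p v Y : Ck_vec 1 Y -> sphere p -> svder p v Y (dvec Y p v).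
Proof. by move=> cY sp i; rewrite mxE; exact: sder_dirder. Qed.

Lemma svderE p v Y L : svder p v Y L -> dvec Y p v = L.
Proof. by move=> sY; apply/rowP => i; rewrite mxE; exact: sderE (sY i). Qed.

Lemma svder_id p v : sphere p -> tangent p v -> svder p v id v.
Proof. by move=> sp tv i; exact: sder_coord. Qed.

Lemma svder_cst p v w : svder p v (fun=> w) 0.
Proof. by move=> i; rewrite mxE; exact: sder_cst. Qed.

Lemma sder_eq p v f l l' : sder p v f l -> l = l' -> sder p v f l'.
Proof. by move=> ? <-. Qed.

Lemma sder_dot p v Y Z L M : sphere p -> svder p v Y L -> svder p v Z M ->
  sder p v (fun q => dot (Y q) (Z q)) (dot L (Z p) + dot (Y p) M).
Proof.
move=> sp sY sZ; rewrite (_ : (fun q => _) = (fun q => Y q 0 0 * Z q 0 0 +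
   Y q 0 1 * Z q 0 1 + Y q 0 2 * Z q 0 2)); last by apply/funext => q; rewrite dotE.
have H i := sderM sp (sY i) (sZ i).
apply: (sder_eq (sderD (sderD (H 0) (H 1)) (H 2))).
rewrite !dotE; ring.
Qed.

Lemma svder_cross p v Y Z L M : sphere p -> svder p v Y L -> svder p v Z M ->
  svder p v (fun q => cross (Y q) (Z q)) (cross L (Z p) + cross (Y p) M).
Proof.
move=> sp sY sZ.
have H i j : sder p v (fun q => Y q 0 i * Z q 0 j - Y q 0 j * Z q 0 i)
   (L 0 i * Z p 0 j - L 0 j * Z p 0 i + (Y p 0 i * M 0 j - Y p 0 j * M 0 i)).
  apply: (sder_eq (sderB (sderM sp (sY i) (sZ j)) (sderM sp (sY j) (sZ i)))); ring.
by apply: ord3P; rewrite mxE /cross !row3E; under eq_fun do rewrite !row3E; exact: H.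
Qed.

Lemma svderD p v Y Z L M : svder p v Y L -> svder p v Z M ->
  svder p v (fun q => Y q + Z q) (L + M).
Proof.
move=> sY sZ i; rewrite mxE; under eq_fun do rewrite mxE.
exact: sderD.
Qed.

Lemma svderN p v Y L : svder p v Y L -> svder p v (fun q => - Y q) (- L).
Proof.
move=> sY i; rewrite mxE; under eq_fun do rewrite mxE.
exact: sderN.
Qed.

Lemma svderZ p v f Y l L : sphere p -> sder p v f l -> svder p v Y L ->
  svder p v (fun q => f q *: Y q) (l *: Y p + f p *: L).
Proof.
move=> sp sf sY i; under eq_fun do rewrite mxE.
apply: (sder_eq (sderM sp sf (sY i))).
rewrite !mxE; ring.
Qed.

Lemma dvec_congr Y Z p v : (forall q, sphere q -> Y q = Z q) -> sphere p ->
  dvec Y p v = dvec Z p v.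
Proof.
move=> YZ sp; apply/rowP => i; rewrite !mxE; apply: dirder_congr => // q sq.
by rewrite YZ.
Qed.

Lemma frame_tangent p e1 e2 : frame p e1 e2 -> [/\ sphere p, tangent p e1 & tangent p e2].
Proof. by case=> -[]. Qed.

Lemma cross_frame p e1 e2 : frame p e1 e2 ->
  [/\ cross p e1 = e2, cross p e2 = - e1 & cross e1 e2 = p] /\
  [/\ cross e1 p = - e2, cross e2 p = e1 & cross e2 e1 = - p].
Proof.
move=> [_ [_ c12 c2p cp1]]; rewrite cp1 c12 c2p; split; split=> //.
- by rewrite cross_anti c2p.
- by rewrite cross_anti cp1.
- by rewrite cross_anti c12.
Qed.

Lemma dot_grad f p w : Ck_sphere 1 f -> sphere p -> dot (grad f p) w = dirder f p w.
Proof. by move=> cf sp; rewrite (dirder_basis _ cf sp) dotC dotE !mxE. Qed.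

Lemma grad_frame f p e1 e2 : Ck_sphere 1 f -> frame p e1 e2 ->
  grad f p = dirder f p e1 *: e1 + dirder f p e2 *: e2.
Proof.
move=> cf fr; have [sp t1 t2] := frame_tangent fr.
by rewrite [LHS](frame_decomposition _ fr) !dot_grad// (dirder_radial cf sp) scale0r addr0.
Qed.

Lemma Ck_grad k f : Ck_sphere k.+1 f -> Ck_vec k (grad f).
Proof.
move=> cf i; under eq_fun do rewrite mxE.
exact: Ck_sphere_dirder.
Qed.

(** The gradient in R^3, at a point of the sphere, of the extension of [f]
homogeneous of degree 1. For a linear [f] it is constant, and its derivative is
the obstruction to linearity. *)
Definition hgrad f p := f p *: p + grad f p.

Lemma Ck_hgrad k f : Ck_sphere k.+1 f -> Ck_vec k (hgrad f).
Proof.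
move=> cf i; under eq_fun do rewrite mxE mxE.
apply: Ck_sphereD; last exact: Ck_grad.
by apply: Ck_sphereM; [exact: Ck_sphereS|exact: Ck_sphere_coord].
Qed.

Lemma dot_hgrad f p w : Ck_sphere 1 f -> sphere p ->
  dot (hgrad f p) w = f p * dot p w + dirder f p w.
Proof. by move=> cf sp; rewrite dotDl dotZl dot_grad. Qed.

(** This derivative is the Hessian of the homogeneous extension of degree 1,
hence symmetric. *)
Lemma dvec_hgrad_sym f p v w : Ck_sphere 2 f -> sphere p -> tangent p v -> tangent p w ->
  dot (dvec (hgrad f) p v) w = dot (dvec (hgrad f) p w) v.
Proof.
move=> cf sp tv tw; have cf1 := Ck_sphereS cf.
have H v' w' : tangent p v' -> tangent p w' -> dot (dvec (hgrad f) p v') w' =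
    f p * dot v' w' + dirder (fun q => dirder f q w') p v'.
  move=> tv' tw'.
  have s1 := sder_dot sp (svder_dvec v' (Ck_hgrad cf) sp) (svder_cst p v' w').
  have s2 := sderD (sderM sp (sder_dirder v' cf1 sp) (sder_dot sp (svder_id sp tv') (svder_cst p v' w')))
     (sder_dirder v' (Ck_sphere_dirder w' cf) sp).
  have := sderE s1; rewrite (_ : dot (hgrad f p) 0 = 0) ?addr0; last by rewrite dotC dot0l.
  move=> <-; rewrite (@dirder_congr _ _ (fun q => f q * dot q w' + dirder f q w'))//; last first.
    by move=> q sq; exact: dot_hgrad.
  by rewrite (sderE s2) tw' mul0r addr0 [dot _ 0]dotC dot0l addr0.
transitivity (f p * dot v w + dirder (fun q => dirder f q w) p v); first exact: H.
transitivity (f p * dot w v + dirder (fun q => dirder f q v) p w); last exact/esym/H.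
exact: (congr2 (fun x y => f p * x + y) (dotC v w) (dirder_commute cf sp tw tv)).
Qed.

(** Gradients of functions homogeneous of degree 1 are homogeneous of degree 0,
so the Hessian annihilates the radial direction. *)
Lemma dvec_hgrad_tangent f p v : Ck_sphere 2 f -> sphere p -> tangent p v ->
  dot (dvec (hgrad f) p v) p = 0.
Proof.
move=> cf sp tv; have cf1 := Ck_sphereS cf.
have := sderE (sder_dot sp (svder_dvec v (Ck_hgrad cf) sp) (svder_id sp tv)).
rewrite (@dirder_congr _ _ f)//; last first.
  by move=> q sq; rewrite dot_hgrad// dirder_radial// addr0 sq mulr1.
rewrite dot_hgrad// tv mulr0 add0r => /esym/eqP.
by rewrite -subr_eq0 addrK => /eqP.
Qed.

Lemma dvecE Y p v i : dvec Y p v 0 i = dirder (fun q => Y q 0 i) p v.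
Proof. by rewrite mxE. Qed.

(** Summing the 2-forms [dY_i /\ dZ_i] pairs the derivatives of [Y] and [Z] by
the Euclidean product. *)
Lemma wedge_jac Y Z (t s : R) :
  dot (dvec Y (sph t s) (polar t s)) (dvec Z (sph t s) (azimuthal t s)) -
  dot (dvec Y (sph t s) (azimuthal t s)) (dvec Z (sph t s) (polar t s)) =
  jac (fun q => Y q 0 0) (fun q => Z q 0 0) t s +
  jac (fun q => Y q 0 1) (fun q => Z q 0 1) t s +
  jac (fun q => Y q 0 2) (fun q => Z q 0 2) t s.
Proof.
have E (A B C D : 'rV[R]_3) : dot A B - dot C D =
   (A 0 0 * B 0 0 - C 0 0 * D 0 0) + (A 0 1 * B 0 1 - C 0 1 * D 0 1) +
   (A 0 2 * B 0 2 - C 0 2 * D 0 2) by rewrite !dotE; ring.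
rewrite E.
have J i : dvec Y (sph t s) (polar t s) 0 i * dvec Z (sph t s) (azimuthal t s) 0 i -
    dvec Y (sph t s) (azimuthal t s) 0 i * dvec Z (sph t s) (polar t s) 0 i =
    jac (fun q => Y q 0 i) (fun q => Z q 0 i) t s by rewrite !dvecE.
exact: (congr2 +%R (congr2 +%R (J 0) (J 1)) (J 2)).
Qed.

Lemma derive_ext Y p v : Ck_vec 1 Y -> sphere p -> 'D_v (ext Y) p = dvec Y p v.
Proof.
move=> cY sp.
have D i j : derivable (fun x => ext Y x i j) p v.
  rewrite (ord1 i); apply: diff_derivable.
  exact: (@Ck_sphere_diff _ (fun q => Y q 0 j) p (cY j) sp).
rewrite derive_mx; last exact/derivable_mxP.
by apply/rowP => j; rewrite !mxE.
Qed.

Section Classification.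
Variables (X : 'rV[R]_3 -> 'rV[R]_3) (phi : 'rV[R]_3 -> R).
Hypothesis tX : forall p, sphere p -> tangent p (X p).
Hypothesis cX : forall k, Ck_vec k X.
Hypothesis lieX : forall p v w, sphere p -> tangent p v -> tangent p w ->
  lie_metric X p v w = phi p * dot v w.

Lemma lie_dvec p v w : sphere p -> tangent p v -> tangent p w ->
  dot (dvec X p v) w + dot v (dvec X p w) = phi p * dot v w.
Proof.
move=> sp tv tw; rewrite -lieX// /lie_metric /covd !(derive_ext _ (cX 1))// /tproj.
by rewrite dotDl dotDr dotNl dotNr dotZl dotZr tw (dotC v p) tv !mulr0 !subr0.
Qed.

Lemma dvec_normal p v : sphere p -> tangent p v -> dot (dvec X p v) p = - dot (X p) v.
Proof.
move=> sp tv.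
have := sderE (sder_dot sp (svder_dvec v (cX 1) sp) (svder_id sp tv)).
rewrite (@dirder_congr _ _ (fun=> 0))//; last by move=> q sq; rewrite dotC; exact: tX.
by rewrite (sderE (sder_cst p v 0)) => /esym/eqP; rewrite addr_eq0 => /eqP.
Qed.

Let D i j p := dirder (fun q => X q 0 i) p (basis_vec R j).

(** Half the divergence: the radial derivatives of the extended field vanish,
so the trace over R^3 is that over the tangent plane. *)
Definition divh p : R := 2^-1 * (D 0 0 p + D 1 1 p + D 2 2 p).
(** Half the normal component of the curl. *)
Definition curlh p : R := 2^-1 * (p 0 0 * (D 2 1 p - D 1 2 p) +
  p 0 1 * (D 0 2 p - D 2 0 p) + p 0 2 * (D 1 0 p - D 0 1 p)).

Lemma Ck_D k i j : Ck_sphere k (D i j).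
Proof. by apply: Ck_sphere_dirder; exact: cX. Qed.

Lemma Ck_divh k : Ck_sphere k divh.
Proof.
apply: Ck_sphereM; first exact: Ck_sphere_cst.
by apply: Ck_sphereD; [apply: Ck_sphereD|]; exact: Ck_D.
Qed.

Lemma Ck_curlh k : Ck_sphere k curlh.
Proof.
apply: Ck_sphereM; first exact: Ck_sphere_cst.
have H i j k' l m : Ck_sphere k (fun p => p 0 i * (D j k' p - D l m p)).
  by apply: Ck_sphereM; [exact: Ck_sphere_coord|apply: Ck_sphereB; exact: Ck_D].
by apply: Ck_sphereD; [apply: Ck_sphereD|]; exact: H.
Qed.

Lemma dirder_frame f p e1 e2 w : Ck_sphere 1 f -> frame p e1 e2 ->
  dirder f p w = dot w e1 * dirder f p e1 + dot w e2 * dirder f p e2.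
Proof.
move=> cf fr; have [sp _ _] := frame_tangent fr.
rewrite -(dot_grad w cf sp) (grad_frame cf fr) dotDl !dotZl.
by rewrite (dotC e1) (dotC e2) mulrC [X in _ + X]mulrC.
Qed.

Lemma dot_basis w j : dot (basis_vec R j) w = w 0 j.
Proof.
by move: j; apply: ord3P; rewrite dotE !mxE/= ?mul1r ?mul0r ?addr0 ?add0r.
Qed.

Lemma conformal_entries (x11 x12 x21 x22 l : R) :
  x11 + x11 = l * 1 -> x12 + x21 = l * 0 -> x22 + x22 = l * 1 ->
  [/\ x11 = 2^-1 * (x11 + x22), x12 = 2^-1 * (x12 - x21),
      x21 = - (2^-1 * (x12 - x21)) & x22 = 2^-1 * (x11 + x22)].
Proof. by move=> *; split; lra. Qed.

(** The conformal Killing equation leaves only a multiple of the identity and a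
multiple of the rotation by a right angle in the covariant derivative. *)
Lemma frame_jacobian p e1 e2 : frame p e1 e2 ->
  [/\ dot (dvec X p e1) e1 = divh p, dot (dvec X p e1) e2 = curlh p,
      dot (dvec X p e2) e1 = - curlh p & dot (dvec X p e2) e2 = divh p].
Proof.
move=> fr; have [sp t1 t2] := frame_tangent fr.
have [ [_ n1 n2 _ _] [z12 _ _ _] ] := fr.
have [ [cp1 cp2 _] _ ] := cross_frame fr.
have L11 := lie_dvec sp t1 t1; have L12 := lie_dvec sp t1 t2; have L22 := lie_dvec sp t2 t2.
have Dij i j : D i j p = e1 0 j * dvec X p e1 0 i + e2 0 j * dvec X p e2 0 i.
  by rewrite /D (dirder_frame _ (cX 1 i) fr) !dot_basis !mxE.
have dE : divh p = 2^-1 * (dot (dvec X p e1) e1 + dot (dvec X p e2) e2).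
  rewrite /divh !Dij; move: (dvec X p e1) (dvec X p e2) => x1 x2.
  rewrite !dotE; ring.
have cE : curlh p = 2^-1 * (dot (dvec X p e1) e2 - dot (dvec X p e2) e1).
  rewrite -[X in _ * (_ + X)]dotNr -cp2.
  transitivity (2^-1 * (dot (dvec X p e1) (cross p e1) + dot (dvec X p e2) (cross p e2)));
    last by rewrite cp1.
  rewrite /curlh !Dij; move: (dvec X p e1) (dvec X p e2) => x1 x2.
  rewrite !dotE /cross !row3E; ring.
rewrite n1 [dot e1 _]dotC in L11; rewrite n2 [dot e2 _]dotC in L22.
rewrite z12 [dot e1 _]dotC in L12.
by rewrite dE cE; exact: conformal_entries L11 L12 L22.
Qed.

(** The frame version [frame_jacobian], rewritten without a frame in order to
be differentiated once more. The last term is the normal component, forced by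
tangency of [X]. *)
Lemma dirder_killing p w i : sphere p -> dirder (fun q => X q 0 i) p w =
  divh p * (w 0 i - dot p w * p 0 i) + curlh p * cross p w 0 i - dot (X p) w * p 0 i.
Proof.
move=> sp; have [t [s pE]] := sph_surjective sp.
have := frame_sph t s; rewrite -pE; move: (polar t s) (azimuthal t s) => e1 e2 fr.
have [_ t1 t2] := frame_tangent fr.
have [x11 x12 x21 x22] := frame_jacobian fr.
have [ [cp1 cp2 _] _ ] := cross_frame fr.
rewrite (dirder_frame _ (cX 1 i) fr).
have E1 : dirder (fun q => X q 0 i) p e1 = dvec X p e1 0 i by rewrite mxE.
have E2 : dirder (fun q => X q 0 i) p e2 = dvec X p e2 0 i by rewrite mxE.
have wE := frame_decomposition w fr.
have cw : cross p w 0 i = dot w e1 * e2 0 i - dot w e2 * e1 0 i.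
  rewrite cross_anti {1}wE !crossDl !crossZl crossvv.
  by rewrite (cross_anti e1) cp1 (cross_anti e2) cp2 !mxE; ring.
have wi : w 0 i = dot w e1 * e1 0 i + dot w e2 * e2 0 i + dot w p * p 0 i.
  by rewrite {1}wE !mxE.
have Xw : dot (X p) w = dot w e1 * dot (X p) e1 + dot w e2 * dot (X p) e2.
  by rewrite {1}wE !dotDr !dotZr (dotC (X p) p) (tX sp) mulr0 addr0.
have Xi j v : dvec X p v 0 j = dot (dvec X p v) e1 * e1 0 j + dot (dvec X p v) e2 * e2 0 j
    + dot (dvec X p v) p * p 0 j.
  by rewrite {1}[dvec X p v](frame_decomposition _ fr) !mxE.
rewrite E1 E2 (Xi i e1) (Xi i e2) x11 x12 x21 x22.
rewrite (dvec_normal sp t1) (dvec_normal sp t2).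
rewrite cw wi Xw (dotC p w).
move: (dot w e1) (dot w e2) (dot w p) (dot (X p) e1) (dot (X p) e2) (divh p) (curlh p).
move: (e1 0 i) (e2 0 i) (p 0 i) => *; ring.
Qed.

Lemma curvature_entries (x1 x2 a1 a2 b1 b2 b : R) :
  a1 * 1 + (b1 * - 0 + b * 0) - (b * 0 + x2 * 0) =
    a2 * 0 + (b2 * 1 + b * - 0) - (- b * 0 + x1 * 1) ->
  a1 * 0 + (b1 * - 1 + b * 0) - (b * 0 + x2 * 1) =
    a2 * 1 + (b2 * 0 + b * - 0) - (- b * 0 + x1 * 0) ->
  x1 = b2 - a1 /\ x2 = - b1 - a2.
Proof. by move=> *; split; lra. Qed.

(** Comparing the two orders of differentiation in [dirder_killing] recovers
[X] itself from the first derivatives of [divh] and [curlh]: this is the Gauss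
curvature 1 of the sphere at work. *)
Lemma killing_components p e1 e2 : frame p e1 e2 ->
  dot (X p) e1 = dirder curlh p e2 - dirder divh p e1 /\
  dot (X p) e2 = - dirder curlh p e1 - dirder divh p e2.
Proof.
move=> fr; have [sp t1 t2] := frame_tangent fr.
have [ [_ n1 n2 _ _] [z12 _ _ _] ] := fr.
have [ [cp1 cp2 c12] [_ _ c21] ] := cross_frame fr.
have [x11 x12 x21 x22] := frame_jacobian fr.
have ca := Ck_divh 1; have cb := Ck_curlh 1.
(* By dirder_killing, E w is the derivative of X along the constant vector w. *)
pose E w q := divh q *: (w - dot q w *: q) + curlh q *: cross q w - dot (X q) w *: q.
have H v w : tangent p v -> tangent p w -> svder p v (E w)
   (dirder divh p v *: w - divh p *: (dot v w *: p) + (dirder curlh p v *: cross p w +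
    curlh p *: cross v w) - (dot (dvec X p v) w *: p + dot (X p) w *: v)).
  move=> tv tw.
  have sid := svder_id sp tv; have sw := svder_cst p v w.
  have s1 := svderD sw (svderN (svderZ sp (sder_dot sp sid sw) sid)).
  have s2 := svderZ sp (sder_dirder v ca sp) s1.
  have s3 := svderZ sp (sder_dirder v cb sp) (svder_cross sp sid sw).
  have s4 := svderZ sp (sder_dot sp (svder_dvec v (cX 1) sp) sw) sid.
  have := svderD (svderD s2 s3) (svderN s4).
  have d0 (u : 'rV[R]_3) : dot u 0 = 0 by rewrite dotC dot0l.
  have c0 (u : 'rV[R]_3) : cross u 0 = 0.
    by apply: vec3P; rewrite [RHS]mxE /cross !row3E !mxE; ring.
  rewrite /= !d0 c0 !addr0 tw !scale0r !addr0 subr0 add0r scalerN.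
  by move=> h i; apply: h.
have S : dvec (E e2) p e1 = dvec (E e1) p e2.
  apply/rowP => i; rewrite !mxE.
  have K w v : dirder (fun q => E w q 0 i) p v =
      dirder (fun q => dirder (fun q => X q 0 i) q w) p v.
    apply: dirder_congr => // q sq; rewrite dirder_killing// !mxE; ring.
  exact: (etrans (K e2 e1) (etrans (dirder_commute (cX 2 i) sp t2 t1) (esym (K e1 e2)))).
(* S is the symmetry of second derivatives, for w = e1, e2 at p. *)
move: S; rewrite (svderE (H e1 e2 t1 t2)) (svderE (H e2 e1 t2 t1)).
rewrite cp2 cp1 c12 c21 x12 x21 (dotC e2) z12 !scale0r !scaler0 !subr0 => S.
have e1p : dot p e1 = 0 := t1; have e2p : dot p e2 = 0 := t2.
have := congr1 (fun z => dot z e1) S; have := congr1 (fun z => dot z e2) S.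
rewrite !(dotDl, dotNl, dotZl, dotNr) n1 n2 (dotC e2) z12 e1p e2p.
exact: curvature_entries.
Qed.

Lemma dot_frame p e1 e2 v w : frame p e1 e2 ->
  dot v w = dot v e1 * dot w e1 + dot v e2 * dot w e2 + dot v p * dot w p.
Proof.
by move=> fr; rewrite {1}(frame_decomposition w fr) !dotDr !dotZr; congr (_ + _ + _); rewrite mulrC.
Qed.

(** The announced normal form of [X], except that the two vectors still depend
on the point. *)
Lemma killing_hgrad p : sphere p ->
  X p = cross (hgrad curlh p) p - hgrad divh p + divh p *: p.
Proof.
move=> sp; have [t [s pE]] := sph_surjective sp.
have := frame_sph t s; rewrite -pE.
move: (polar t s) (azimuthal t s) => e1 e2 fr.
have [X1 X2] := killing_components fr.
have [ _ [cp1 cp2 _] ] := cross_frame fr.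
rewrite [LHS](frame_decomposition _ fr) X1 X2 [dot _ p]dotC (tX sp) scale0r addr0.
rewrite /hgrad (grad_frame (Ck_curlh 1) fr) (grad_frame (Ck_divh 1) fr).
rewrite !crossDl !crossZl crossvv cp1 cp2.
apply/rowP => i; rewrite !mxE.
move: (dirder _ _ _) (dirder _ _ _) (dirder _ _ _) (dirder _ _ _) (divh p) (curlh p) => *.
ring.
Qed.

Lemma dvec_killing p v : sphere p -> tangent p v -> dvec X p v =
  cross (dvec (hgrad curlh) p v) p + cross (hgrad curlh p) v - dvec (hgrad divh) p v +
  (dirder divh p v *: p + divh p *: v).
Proof.
move=> sp tv; rewrite (dvec_congr v killing_hgrad sp); apply: svderE.
have sid := svder_id sp tv.
apply: svderD; last by apply: svderZ => //; apply: sder_dirder => //; exact: Ck_divh.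
apply: svderD; last by apply/svderN/svder_dvec => //; apply: Ck_hgrad; exact: Ck_divh.
apply: svder_cross => //; apply: svder_dvec => //; apply: Ck_hgrad; exact: Ck_curlh.
Qed.

Lemma cauchy_riemann_entries (a11 a12 a21 a22 b11 b12 b21 b22 a b : R) :
  a12 = a21 -> b12 = b21 ->
  a = b12 + 0 - a11 + a -> b = - b11 + b - a12 -> - b = b22 - b - a21 ->
  a = - b21 + 0 - a22 + a ->
  [/\ b21 = b12, b22 = - b11 & a11 = b12] /\
  [/\ a12 = - b11, a21 = - b11 & a22 = - b12].
Proof. by move=> *; split; split; lra. Qed.

(** Differentiating [killing_hgrad] and comparing with [frame_jacobian] relates
the Hessians [A] and [B] by a rotation by a right angle. Together with their
symmetry, this makes both traceless. *)
Lemma killing_hgrad_entries p e1 e2 : frame p e1 e2 ->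
  let A v w := dot (dvec (hgrad divh) p v) w in
  let B v w := dot (dvec (hgrad curlh) p v) w in
  [/\ B e2 e1 = B e1 e2, B e2 e2 = - B e1 e1 & A e1 e1 = B e1 e2] /\
  [/\ A e1 e2 = - B e1 e1, A e2 e1 = - B e1 e1 & A e2 e2 = - B e1 e2].
Proof.
move=> fr A B; have [sp t1 t2] := frame_tangent fr.
have ca := Ck_divh 2; have cb := Ck_curlh 2.
have [ [pp n1 n2 p1 p2] [z12 _ _ _] ] := fr.
have [ [cp1 cp2 c12] [_ _ c21] ] := cross_frame fr.
have [x11 x12 x21 x22] := frame_jacobian fr.
have H v w : tangent p v -> dot p w = 0 -> dot (dvec X p v) w =
    dot (dvec (hgrad curlh) p v) (cross p w) + dot (hgrad curlh p) (cross v w) - A v w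
    + divh p * dot v w.
  move=> tv tw; rewrite dvec_killing// /A.
  move: (dvec (hgrad curlh) p v) (hgrad curlh p) (dvec (hgrad divh) p v) => V r W.
  by rewrite !dotDl dotNl !dotZl !dot_cross tw mulr0 add0r.
have rp : dot (hgrad curlh p) p = curlh p.
  by rewrite dot_hgrad ?pp ?mulr1 ?dirder_radial ?addr0//; exact: Ck_curlh.
have E11 := H e1 e1 t1 t1; have E12 := H e1 e2 t1 t2.
have E21 := H e2 e1 t2 t1; have E22 := H e2 e2 t2 t2.
rewrite x11 cp1 crossvv n1 mulr1 [dot _ 0]dotC dot0l in E11.
rewrite x12 cp2 c12 z12 mulr0 addr0 dotNr rp in E12.
rewrite x21 cp1 c21 [dot e2 e1]dotC z12 mulr0 addr0 dotNr rp in E21.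
rewrite x22 cp2 crossvv n2 mulr1 [dot _ 0]dotC dot0l dotNr in E22.
exact: (cauchy_riemann_entries (dvec_hgrad_sym ca sp t1 t2)
  (dvec_hgrad_sym cb sp t1 t2) E11 E12 E21 E22).
Qed.

Lemma wedge_entries p e1 e2 (A1 A2 B1 B2 : 'rV[R]_3) : frame p e1 e2 ->
  dot A1 p = 0 -> dot A2 p = 0 ->
  dot B2 e1 = dot B1 e2 -> dot B2 e2 = - dot B1 e1 ->
  dot A1 e1 = dot B1 e2 -> dot A1 e2 = - dot B1 e1 ->
  dot A2 e1 = - dot B1 e1 -> dot A2 e2 = - dot B1 e2 ->
  dot A1 B2 - dot A2 B1 = 2 * (dot B1 e1 ^+ 2 + dot B1 e2 ^+ 2).
Proof.
move=> fr A1p A2p b21 b22 a11 a12 a21 a22.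
rewrite (dot_frame A1 _ fr) (dot_frame A2 _ fr) A1p A2p a11 a12 a21 a22 b21 b22.
move: (dot B1 e1) (dot B1 e2) => b c; ring.
Qed.

(** By [killing_hgrad_entries] the mixed determinant of the two Hessians is a
sum of squares. *)
Lemma wedge_hgrad p e1 e2 : frame p e1 e2 ->
  dot (dvec (hgrad divh) p e1) (dvec (hgrad curlh) p e2) -
  dot (dvec (hgrad divh) p e2) (dvec (hgrad curlh) p e1) =
  2 * (dot (dvec (hgrad curlh) p e1) e1 ^+ 2 + dot (dvec (hgrad curlh) p e1) e2 ^+ 2).
Proof.
move=> fr; have [sp t1 t2] := frame_tangent fr.
have ca := Ck_divh 2; have cb := Ck_curlh 2.
have [ [b21 b22 a11] [a12 a21 a22] ] := killing_hgrad_entries fr.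
exact: (wedge_entries fr (dvec_hgrad_tangent ca sp t1) (dvec_hgrad_tangent ca sp t2)
  b21 b22 a11 a12 a21 a22).
Qed.

Lemma dvec_hgrad_eq0 p e1 e2 : frame p e1 e2 ->
  dot (dvec (hgrad curlh) p e1) e1 ^+ 2 + dot (dvec (hgrad curlh) p e1) e2 ^+ 2 = 0 ->
  [/\ dvec (hgrad curlh) p e1 = 0, dvec (hgrad curlh) p e2 = 0,
      dvec (hgrad divh) p e1 = 0 & dvec (hgrad divh) p e2 = 0].
Proof.
move=> fr /eqP; rewrite paddr_eq0 ?sqr_ge0// !sqrf_eq0 => /andP[/eqP b11 /eqP b12].
have [sp t1 t2] := frame_tangent fr.
have ca := Ck_divh 2; have cb := Ck_curlh 2.
have [ [b21 b22 a11] [a12 a21 a22] ] := killing_hgrad_entries fr.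
have Z f v : Ck_sphere 2 f -> tangent p v -> dot (dvec (hgrad f) p v) e1 = 0 ->
    dot (dvec (hgrad f) p v) e2 = 0 -> dvec (hgrad f) p v = 0.
  move=> cf tv z1 z2; rewrite [LHS](frame_decomposition _ fr) z1 z2.
  by rewrite dvec_hgrad_tangent// !scale0r !addr0.
have N (x y : R) : y = - x -> x = 0 -> y = 0 by move=> -> ->; rewrite oppr0.
split.
- exact: (Z _ _ cb t1 b11 b12).
- exact: (Z _ _ cb t2 (etrans b21 b12) (N _ _ b22 b11)).
- exact: (Z _ _ ca t1 (etrans a11 b12) (N _ _ a12 b11)).
- exact: (Z _ _ ca t2 (N _ _ a21 b11) (N _ _ a22 b12)).
Qed.

(** The sum of squares of [wedge_hgrad] is, by [wedge_jac], the density of a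
sum of wedge products, so Stokes applies. *)
Lemma null_form_hgrad : null_form (fun t s =>
  2 * (dot (dvec (hgrad curlh) (sph t s) (polar t s)) (polar t s) ^+ 2 +
       dot (dvec (hgrad curlh) (sph t s) (polar t s)) (azimuthal t s) ^+ 2)).
Proof.
have ca := Ck_hgrad (Ck_divh 2); have cb := Ck_hgrad (Ck_curlh 2).
have := null_formD (null_formD (null_jac (ca 0) (cb 0)) (null_jac (ca 1) (cb 1)))
  (null_jac (ca 2) (cb 2)).
congr null_form; apply/funext => t; apply/funext => s.
by rewrite -(wedge_hgrad (frame_sph t s)); exact/esym/wedge_jac.
Qed.

End Classification.
End ConformalKilling.

(** * Conformal Killing fields have six parameters *)

Section KillingConstants.
Variable R : realType.
Notation sph := (@spherical R).

Lemma constant_segment (g dg : R -> R) (a b : R) :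
  (forall t : R, is_derive t 1 g (dg t)) -> (forall t, a < t < b -> dg t = 0) ->
  forall t, a <= t <= b -> g t = g a.
Proof.
move=> dG dg0 t /andP[]; rewrite le_eqVlt => /predU1P[->//|at_ tb].
have cg : {within `[a, t], continuous g}.
  by apply: derivable_within_continuous => x _; have [] := dG x.
have [c] := MVT at_ (fun x _ => dG x) cg.
rewrite in_itv/= => /andP[ac ct]; rewrite dg0 ?mul0r; last by rewrite ac (lt_le_trans ct).
by move/eqP; rewrite subr_eq0 => /eqP.
Qed.

Lemma sph_pole (t s s' : R) : sin t = 0 -> sph t s = sph t s'.
Proof. by move=> st; rewrite !sphE st !mul0r. Qed.

(** The derivatives are only known to vanish inside the coordinate rectangle;
its boundary is reached along meridians and parallels. *)
Lemma constant_on_sphere (f : 'rV[R]_3 -> R) : Ck_sphere 1 f ->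
  (forall t s : R, 0 < t < pi -> 0 < s < 2 * pi ->
     dirder f (sph t s) (polar t s) = 0 /\ dirder f (sph t s) (azimuthal t s) = 0) ->
  forall t s : R, 0 <= t <= pi -> 0 <= s <= 2 * pi -> f (sph t s) = f (sph 0 0).
Proof.
move=> cf df t s tI sI; have [_ _ _ d1 d2] := C1plane_sph cf.
have pi0 := pi_gt0 R.
have Hpi : 0 < (pi : R) < 2 * (pi : R) by rewrite pi0 mulr_natl mulr2n ltrDl.
have A t' s' : 0 <= t' <= pi -> 0 < s' < 2 * pi -> f (sph t' s') = f (sph 0 0).
  move=> t'I s'I; rewrite (@sph_pole 0 0 s') ?sin0//.
  apply: (constant_segment (fun t => d1 t s') _ t'I) => x xI.
  by have [] := df x s' xI s'I.
have [st0|st0] := eqVneq (sin t) 0; first by rewrite (sph_pole s pi st0) A.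
have tI' : 0 < t < pi.
  move/andP: tI => [t0 t1]; rewrite !lt_neqAle t0 t1 !andbT; apply/andP; split.
    by apply: contraNneq st0 => <-; rewrite sin0.
  by apply: contraNneq st0 => ->; rewrite sinpi.
have B s' : 0 <= s' <= 2 * pi -> f (sph t s') = f (sph t 0).
  move=> s'I; apply: (constant_segment (d2 t) _ s'I) => x xI.
  by have [_ ->] := df t x tI' xI; rewrite mulr0.
by rewrite B// -(B pi) ?A//; have /andP[h1 h2] := Hpi; rewrite !ltW.
Qed.

(** The sum of squares in [null_form_hgrad] has integral 0, so it vanishes, and
with it the derivatives of the two vectors of [killing_hgrad]. *)
Lemma conformal_killing_on_sphere (X : 'rV[R]_3 -> 'rV[R]_3) : conformal_killing X ->
  exists r c : 'rV[R]_3, forall t s : R, 0 <= t <= pi -> 0 <= s <= 2 * pi ->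
  X (sph t s) = cross r (sph t s) + c - dot c (sph t s) *: sph t s.
Proof.
move=> [tX cX [phi lieX]].
have cX' k : Ck_vec k X by move=> i; exact: cX.
have [cQ IQ] := null_form_hgrad tX cX' lieX.
have ca := Ck_hgrad (Ck_divh cX' 2); have cb := Ck_hgrad (Ck_curlh cX' 2).
have Z t s : 0 < t < pi -> 0 < s < 2 * pi ->
  [/\ dvec (hgrad (curlh X)) (sph t s) (polar t s) = 0,
      dvec (hgrad (curlh X)) (sph t s) (azimuthal t s) = 0,
      dvec (hgrad (divh X)) (sph t s) (polar t s) = 0 &
      dvec (hgrad (divh X)) (sph t s) (azimuthal t s) = 0].
  move=> tI sI; apply: (dvec_hgrad_eq0 tX cX' lieX (frame_sph t s)).
  have st : 0 < sin t by exact: sin_gt0_pi.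
  have := integral2_eq0 cQ _ IQ tI sI.
  set q := _ + _ => H; have /eqP : 2 * q * sin t = 0.
    apply: H => t' s' t'I; apply: mulr_ge0; last exact: sin_ge0_pi.
    by apply: mulr_ge0 => //; apply: addr_ge0; exact: sqr_ge0.
  by rewrite !mulf_eq0 (gt_eqF st) orbF pnatr_eq0 => /eqP.
have Kb t s : 0 <= t <= pi -> 0 <= s <= 2 * pi ->
    hgrad (curlh X) (sph t s) = hgrad (curlh X) (sph 0 0).
  move=> tI sI; apply/rowP => i.
  apply: (constant_on_sphere (cb i)) => // t' s' t'I s'I.
  by have [z1 z2 _ _] := Z t' s' t'I s'I; rewrite -!dvecE z1 z2 mxE.
have Ka t s : 0 <= t <= pi -> 0 <= s <= 2 * pi ->
    hgrad (divh X) (sph t s) = hgrad (divh X) (sph 0 0).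
  move=> tI sI; apply/rowP => i.
  apply: (constant_on_sphere (ca i)) => // t' s' t'I s'I.
  by have [_ _ z1 z2] := Z t' s' t'I s'I; rewrite -!dvecE z1 z2 mxE.
exists (hgrad (curlh X) (sph 0 0)), (- hgrad (divh X) (sph 0 0)) => t s tI sI.
have sp := sphere_sph t s; have ca1 := Ck_divh cX' 1.
rewrite [LHS](killing_hgrad tX cX' lieX sp) (Kb t s tI sI) (Ka t s tI sI).
congr (_ + _); rewrite dotNl scaleNr opprK; congr (_ *: _).
by rewrite -(Ka t s tI sI) dot_hgrad// dirder_radial// addr0 sp mulr1.
Qed.

End KillingConstants.

(** * The lift to the null cone *)

Section NullConeLift.
Variable R : realType.
Notation sph := (@spherical R).
Implicit Types (p v w e : 'rV[R]_3) (Y Z : 'rV[R]_3 -> 'rV[R]_3).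

(** The [k]-th component of the cross product is the sum of [dY_i /\ dZ_j] and
[dZ_i /\ dY_j], for [i], [j], [k] in cyclic order. *)
Lemma null_cross Y Z (c : 'rV[R]_3) : Ck_vec 1 Y -> Ck_vec 1 Z ->
  null_form (fun t s => dot c
    (cross (dvec Y (sph t s) (polar t s)) (dvec Z (sph t s) (azimuthal t s)) -
     cross (dvec Y (sph t s) (azimuthal t s)) (dvec Z (sph t s) (polar t s)))).
Proof.
move=> cY cZ.
have J i j k : null_form (fun t s => c 0 k * (jac (fun q => Y q 0 i) (fun q => Z q 0 j) t s
    + -1 * jac (fun q => Y q 0 j) (fun q => Z q 0 i) t s)).
  apply/null_formZ/null_formD; first exact: null_jac.
  by apply: null_formZ; exact: null_jac.
have := null_formD (null_formD (J 1 2 0) (J 2 0 1)) (J 0 1 2).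
congr null_form; apply/funext => t; apply/funext => s.
have E (A B C D : 'rV[R]_3) : dot c (cross A B - cross C D) =
   c 0 0 * ((A 0 1 * B 0 2 - C 0 1 * D 0 2) + -1 * (A 0 2 * B 0 1 - C 0 2 * D 0 1)) +
   c 0 1 * ((A 0 2 * B 0 0 - C 0 2 * D 0 0) + -1 * (A 0 0 * B 0 2 - C 0 0 * D 0 2)) +
   c 0 2 * ((A 0 0 * B 0 1 - C 0 0 * D 0 1) + -1 * (A 0 1 * B 0 0 - C 0 1 * D 0 0)).
  by rewrite dotE !mxE /=; ring.
rewrite E.
have D i j : jac (fun q => Y q 0 i) (fun q => Z q 0 j) t s =
    dvec Y (sph t s) (polar t s) 0 i * dvec Z (sph t s) (azimuthal t s) 0 j -
    dvec Y (sph t s) (azimuthal t s) 0 i * dvec Z (sph t s) (polar t s) 0 j.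
  by rewrite /jac !dvecE.
have H i j k := congr1 ( *%R (c 0 k)) (congr2 (fun x y => x + -1 * y) (D i j) (D j i)).
exact: (congr2 +%R (congr2 +%R (H 1 2 0) (H 2 0 1)) (H 0 1 2)).
Qed.

Variable u : 'rV[R]_3 -> R.
Hypothesis cu : Ck_sphere 2 u.

Let cu1 : Ck_sphere 1 u := Ck_sphereS cu.
Let cG : Ck_vec 1 (grad u) := Ck_grad cu.

(** The factor [y] with [e^u g = y^-2 g]. *)
Definition density q := expR (- (2^-1 * u q)).
(** Time component of the null normal to the surface [y^-1 (1, p)] of the light
cone. *)
Definition cone0 q := 2^-1 * density q * (1 + 4^-1 * dot (grad u q) (grad u q)).
(** Space component of the same null normal. *)
Definition cone q := cone0 q *: q - density q *: (q - 2^-1 *: grad u q).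

Lemma Ck_density : Ck_sphere 2 density.
Proof.
apply/Ck_sphere_expR/Ck_sphereN/Ck_sphereM; first exact: Ck_sphere_cst.
exact: cu.
Qed.

Lemma Ck_cone0 : Ck_sphere 1 cone0.
Proof.
apply: Ck_sphereM.
  by apply: Ck_sphereM; [exact: Ck_sphere_cst|exact/Ck_sphereS/Ck_density].
apply: Ck_sphereD; first exact: Ck_sphere_cst.
apply: Ck_sphereM; first exact: Ck_sphere_cst.
under eq_fun do rewrite dotE.
by apply: Ck_sphereD; [apply: Ck_sphereD|]; apply: Ck_sphereM; exact: cG.
Qed.

Lemma Ck_cone : Ck_vec 1 cone.
Proof.
move=> i; under eq_fun do rewrite !mxE.
apply: Ck_sphereB.
  by apply: Ck_sphereM; [exact: Ck_cone0|exact: Ck_sphere_coord].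
apply: Ck_sphereM; first exact/Ck_sphereS/Ck_density.
apply: Ck_sphereB; first exact: Ck_sphere_coord.
apply: Ck_sphereM; first exact: Ck_sphere_cst.
exact: Ck_sphere_dirder.
Qed.

Lemma A_tensorE p v w : sphere p -> tangent p w ->
  A_tensor u p v w = - dot (dvec (grad u) p v) w + 2^-1 * (dirder u p v * dirder u p w)
   - 4^-1 * dot (grad u p) (grad u p) * dot v w + dot v w.
Proof.
move=> sp tw; rewrite /A_tensor /hess /covd (derive_ext v cG sp) /tproj dotDl dotNl dotZl.
by rewrite tw mulr0 subr0 /gauss_curvature mul1r.
Qed.

Lemma dvec_grad_normal p e : sphere p -> tangent p e ->
  dot (dvec (grad u) p e) p = - dirder u p e.
Proof.
move=> sp te.
have := sderE (sder_dot sp (svder_dvec e cG sp) (svder_id sp te)).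
rewrite (@dirder_congr _ _ (fun=> 0))//; last first.
  by move=> q sq; rewrite dot_grad// dirder_radial.
rewrite (sderE (sder_cst p e 0)) dot_grad// => /esym/eqP.
by rewrite addr_eq0 => /eqP.
Qed.

Lemma sder_density p e : sphere p -> sder p e density (density p * - (2^-1 * dirder u p e)).
Proof.
move=> sp; apply: sder_expR => //; apply: sderN; apply: sderZ.
exact: sder_dirder.
Qed.

Lemma dot_grad_frame p e1 e2 : frame p e1 e2 ->
  dot (grad u p) (grad u p) = dirder u p e1 ^+ 2 + dirder u p e2 ^+ 2.
Proof.
move=> fr; have [sp _ _] := frame_tangent fr.
by rewrite {1}(grad_frame cu1 fr) dotDl !dotZl ![dot _ (grad u p)]dotC !dot_grad// !expr2.
Qed.

Lemma cone0_entries (y h1 h2 g1 g2 a1 a2 : R) :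
  2^-1 * y * (4^-1 * ((g1 * h1 + g2 * h2) *+ 2)) +
  (1 + 4^-1 * (g1 ^+ 2 + g2 ^+ 2)) * (2^-1 * (y * - (2^-1 * (a1 * g1 + a2 * g2)))) =
  - (4^-1 * y *
     ((- h1 + 2^-1 * ((a1 * g1 + a2 * g2) * g1) - 4^-1 * (g1 ^+ 2 + g2 ^+ 2) * a1 + a1) * g1 +
      (- h2 + 2^-1 * ((a1 * g1 + a2 * g2) * g2) - 4^-1 * (g1 ^+ 2 + g2 ^+ 2) * a2 + a2) * g2)).
Proof. by field. Qed.

(** The derivative involves second derivatives of [u] only through the tensor
[A]. *)
Lemma sder_cone0 p e1 e2 e : frame p e1 e2 -> tangent p e ->
  sder p e cone0 (- (4^-1 * density p *
    (A_tensor u p e e1 * dirder u p e1 + A_tensor u p e e2 * dirder u p e2))).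
Proof.
move=> fr te; have [sp t1 t2] := frame_tangent fr.
have sG := svder_dvec e cG sp.
have := sderM sp (sderZ 2^-1 (sder_density e sp))
  (sderD (sder_cst p e 1) (sderZ 4^-1 (sder_dot sp sG sG))).
move=> /sder_eq; apply.
rewrite !A_tensorE// (dot_grad_frame fr) add0r.
rewrite [dot (grad u p) (dvec _ _ _)]dotC -mulr2n.
rewrite [in dot _ (grad u p)](grad_frame cu1 fr) dotDr !dotZr.
rewrite (dirder_frame e cu1 fr).
exact: cone0_entries.
Qed.

(** Null normality forces the normal component to equal the derivative of
[cone0]; the tangential one is [A] up to the factor [- y / 2]. *)
Lemma svder_cone p e1 e2 e : frame p e1 e2 -> tangent p e ->
  svder p e cone (- (4^-1 * density p *
    (A_tensor u p e e1 * dirder u p e1 + A_tensor u p e e2 * dirder u p e2)) *: p -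
    (2^-1 * density p) *: (A_tensor u p e e1 *: e1 + A_tensor u p e e2 *: e2)).
Proof.
move=> fr te i; have [sp t1 t2] := frame_tangent fr.
have sid := svder_id sp te.
have H := svderD (svderZ sp (sder_cone0 fr te) sid)
  (svderN (svderZ sp (sder_density e sp)
    (svderD sid (svderN (svderZ sp (sder_cst p e 2^-1) (svder_dvec e cG sp)))))).
apply: (sder_eq (H i)).
have E := frame_decomposition (dvec (grad u) p e) fr.
rewrite (dvec_grad_normal sp te) (dirder_frame e cu1 fr) in E.
have eE := frame_decomposition e fr; rewrite [dot e p]dotC te scale0r addr0 in eE.
have GE := grad_frame cu1 fr.
rewrite !A_tensorE// /cone0 (dot_grad_frame fr) (dirder_frame e cu1 fr).
move: (dvec (grad u) p e) (grad u p) (density p) E GE => V G y.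
move: (dot V e1) (dot V e2) (dirder u p e1) (dirder u p e2) => h1 h2 g1 g2.
move: (dot e e1) (dot e e2) eE => a1 a2 -> -> ->.
rewrite !mxE; move: (e1 0 i) (e2 0 i) (p 0 i) => x1 x2 x3.
by field.
Qed.

Variable K : 'rV[R]_3 -> R.

Lemma det2 (M : 'M[R]_2) : \det M = M 0 0 * M 1 1 - M 0 1 * M 1 0.
Proof.
rewrite (expand_det_row _ 0) !big_ord_recl big_ord0 addr0 /cofactor !det_mx11 !mxE /=.
rewrite expr0 expr1 mul1r mulN1r mulrN.
by congr (M _ _ * M _ _ - M _ _ * M _ _); exact: val_inj.
Qed.

Lemma ord2P (P : 'I_2 -> Prop) : P 0 -> P 1 -> forall i, P i.
Proof.
move=> P0 P1; case=> -[|[|//]] i2; [have -> : Ordinal i2 = 0|have -> : Ordinal i2 = 1] => //;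
  exact: val_inj.
Qed.

(** In an orthonormal frame the Gram matrix of [e^u g] is scalar, so the
constant coefficient of the characteristic polynomial is [e^(-2u) det A]. *)
Lemma sigma2_frame p e1 e2 : frame p e1 e2 -> solves_sigma2 K u ->
  K p * expR (u p) ^+ 2 =
  A_tensor u p e1 e1 * A_tensor u p e2 e2 - A_tensor u p e1 e2 * A_tensor u p e2 e1.
Proof.
move=> fr hK; have [sp t1 t2] := frame_tangent fr.
have [ [_ n1 n2 _ _] [z12 _ _ _] ] := fr.
have [l [eig sig _] ] := hK p sp.
pose E : 'M[R]_(2, 3) := \matrix_(i < 2) [:: e1; e2]`_i.
have E0 : row 0 E = e1 by rewrite rowK.
have E1 : row 1 E = e2 by rewrite rowK.
have EE i j : dot (row i E) (row j E) = (i == j)%:R.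
  have z21 : dot e2 e1 = 0 by rewrite dotC.
  by move: i; apply: ord2P; move: j; apply: ord2P; rewrite ?E0 ?E1 ?n1 ?n2 ?z12 ?z21.
have tb : tangent_basis p E.
  split; first by apply: ord2P; rewrite ?E0 ?E1.
  apply/row_freeP; exists E^T; apply/matrixP => i j; rewrite [RHS]mxE -EE mxE.
  by apply: eq_bigr => k _; rewrite !mxE.
have G : form_mx E (conf_metric u p) = (expR (u p))%:M.
  apply/matrixP => i j; rewrite [LHS]mxE [RHS]mxE /conf_metric EE.
  by rewrite mulr_natr.
have := eig E tb; rewrite G invmx_scalar mul_scalar_mx => cp.
have := congr1 (fun q : {poly R} => q`_0) cp.
rewrite char_poly_det detZ expr2 mulrNN mulr1 mul1r coef0M !coefB !coefX !coefC /=.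
rewrite !sub0r mulrNN -/(sigma2 l) sig det2 /form_mx !mxE !E0 !E1 => <-.
by field; rewrite gt_eqF// expR_gt0.
Qed.

End NullConeLift.

(** * The Kazdan-Warner identity *)

Section KazdanWarner.
Variable R : realType.
Notation sph := (@spherical R).
Implicit Types (p e : 'rV[R]_3) (Y : 'rV[R]_3 -> 'rV[R]_3).

Lemma dot_cross_frame p e1 e2 c (a0 a1 a2 b0 b1 b2 : R) : frame p e1 e2 ->
  dot c (cross (a0 *: p + a1 *: e1 + a2 *: e2) (b0 *: p + b1 *: e1 + b2 *: e2)) =
  dot c p * (a1 * b2 - a2 * b1) + dot c e1 * (a2 * b0 - a0 * b2) +
  dot c e2 * (a0 * b1 - a1 * b0).
Proof.
move=> fr; have [ [cp1 cp2 c12] [c1p c2p c21] ] := cross_frame fr.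
have L v : cross v (b0 *: p + b1 *: e1 + b2 *: e2) =
    b0 *: cross v p + b1 *: cross v e1 + b2 *: cross v e2.
  by rewrite cross_anti !crossDl !crossZl !opprD -!scalerN -!cross_anti.
rewrite L !crossDl !crossZl !crossvv cp1 cp2 c12 c1p c2p c21.
rewrite !(dotDr, dotZr, dotNr).
have -> : dot c 0 = 0 by rewrite dotC dot0l.
move: (dot c p) (dot c e1) (dot c e2) => *; ring.
Qed.

Lemma Ck_dot_cst k r Y : Ck_vec k Y -> Ck_sphere k (fun q => dot r (Y q)).
Proof.
move=> cY; under eq_fun do rewrite dotE.
have H i : Ck_sphere k (fun q => r 0 i * Y q 0 i).
  by apply: Ck_sphereM; [exact: Ck_sphere_cst|exact: cY].
by apply: Ck_sphereD; [apply: Ck_sphereD|]; exact: H.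
Qed.

Lemma dirder_dot_cst r Y p e : Ck_vec 1 Y -> sphere p ->
  dirder (fun q => dot r (Y q)) p e = dot r (dvec Y p e).
Proof.
move=> cY sp; rewrite (sderE (sder_dot sp (svder_cst p e r) (svder_dvec e cY sp))).
by rewrite dot0l add0r.
Qed.

Lemma Ck_vec_id k : Ck_vec k (@id 'rV[R]_3).
Proof. by move=> i; exact: Ck_sphere_coord. Qed.

(** The equation [K e^(2u) = det A] enters only through [K e^u = y^2 det A];
the terms that do not contain the derivatives of [K] cancel against the minors
of [dN]. Indices 0, 1, 2 stand for components along [p], [e1], [e2]. *)
Lemma kazdan_warner_algebra (E y k K1 K2 g1 g2 A11 A12 A21 A22 r0 r1 r2 c0 c1 c2 : R) :
  k * E ^+ 2 = A11 * A22 - A12 * A21 -> y ^+ 2 * E = 1 ->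
  let F1 := k * (E * g1) + E * K1 in let F2 := k * (E * g2) + E * K2 in
  let n1 := - (4^-1 * y * (A11 * g1 + A12 * g2)) in
  let n2 := - (4^-1 * y * (A21 * g1 + A22 * g2)) in
  let y' := - (2^-1 * y) in
  ((c1 + r2) * K1 + (c2 - r1) * K2) * E =
  (F1 * r2 - F2 * r1) +
  -8 * (n1 * (n2 * r0 + y' * A21 * r1 + y' * A22 * r2) -
        n2 * (n1 * r0 + y' * A11 * r1 + y' * A12 * r2)) +
  (-1 * (- (F1 * c1) - F2 * c2 + 2 * (k * E) * c0) +
   4 * (2 * (c0 * (y' * A11 * (y' * A22) - y' * A12 * (y' * A21)) +
     c1 * (y' * A12 * n2 - n1 * (y' * A22)) +
     c2 * (n1 * (y' * A21) - y' * A11 * n2)))).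
Proof.
move=> hk hy F1 F2 n1 n2 y'.
have H : k * E = y ^+ 2 * (A11 * A22 - A12 * A21).
  by rewrite -hk; transitivity (k * E * (y ^+ 2 * E)); [rewrite hy mulr1|ring].
(* The terms without K1 and K2 collect into (k E - y^2 det A) Q. *)
pose Q := g1 * r2 - g2 * r1 + (g1 * c1 + g2 * c2) - 2 * c0.
transitivity (((c1 + r2) * K1 + (c2 - r1) * K2) * E +
   (k * E - y ^+ 2 * (A11 * A22 - A12 * A21)) * Q).
  by rewrite H subrr mul0r addr0.
by rewrite /Q /F1 /F2 /n1 /n2 /y'; field.
Qed.

Variables K u : 'rV[R]_3 -> R.
Hypothesis cK : Ck_sphere 1 K.
Hypothesis cu : Ck_sphere 2 u.
Hypothesis hK : solves_sigma2 K u.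

Let F q := K q * expR (u q).

Lemma Ck_F : Ck_sphere 1 F.
Proof. by apply: Ck_sphereM => //; apply: Ck_sphere_expR; exact: Ck_sphereS. Qed.

Lemma Ck_Fid : Ck_vec 1 (fun q => F q *: q).
Proof.
move=> i; under eq_fun do rewrite mxE.
by apply: Ck_sphereM; [exact: Ck_F|exact: Ck_sphere_coord].
Qed.

(** The four terms on the right are densities of exact 2-forms. The first and
the third form the divergence of [K e^u X]; the second and the fourth are the
combination of the [dN_a /\ dN_b] that pairs with the rotation [r] and with the
boost [c]. The weights are -8 and 4 because a minor of [dN] carries a factor
[(y / 4) (y / 2)], and because the last difference counts each minor twice. *)
Lemma kazdan_warner_frame p e1 e2 (r c : 'rV[R]_3) : frame p e1 e2 ->
  dirder K p (cross r p + c - dot c p *: p) * expR (u p) =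
  (dirder F p e1 * dot r e2 - dirder F p e2 * dot r e1) +
  -8 * (dirder (cone0 u) p e1 * dot r (dvec (cone u) p e2) -
        dirder (cone0 u) p e2 * dot r (dvec (cone u) p e1)) +
  (-1 * dot c (cross (dvec (fun q => F q *: q) p e1) (dvec id p e2) -
               cross (dvec (fun q => F q *: q) p e2) (dvec id p e1)) +
   4 * dot c (cross (dvec (cone u) p e1) (dvec (cone u) p e2) -
              cross (dvec (cone u) p e2) (dvec (cone u) p e1))).
Proof.
move=> fr; have [sp t1 t2] := frame_tangent fr.
have [ [_ n1 n2 p1 p2] [z12 _ _ _] ] := fr.
have [ [cp1 cp2 c12] [_ _ c21] ] := cross_frame fr.
have cu1 := Ck_sphereS cu.
have E1 := svderE (svder_cone cu fr t1); have E2 := svderE (svder_cone cu fr t2).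
rewrite (sderE (sder_cone0 cu fr t1)) (sderE (sder_cone0 cu fr t2)) E1 E2.
have S e : tangent p e -> dvec (fun q => F q *: q) p e = dirder F p e *: p + F p *: e.
  by move=> te; exact: svderE (svderZ sp (sder_dirder e Ck_F sp) (svder_id sp te)).
rewrite (S e1 t1) (S e2 t2) (svderE (svder_id sp t1)) (svderE (svder_id sp t2)).
have FE e : dirder F p e = K p * (expR (u p) * dirder u p e) + expR (u p) * dirder K p e.
  exact: sderE (sderM sp (sder_dirder e cK sp) (sder_expR sp (sder_dirder e cu1 sp))).
have V (n a b k : R) : n *: p - k *: (a *: e1 + b *: e2) =
    n *: p + (- k * a) *: e1 + (- k * b) *: e2.
  by apply/rowP => i; rewrite !mxE; ring.
rewrite !V.
have W0 f (f1 f2 : R) : dot c (cross (f1 *: p + f *: e1) e2 - cross (f2 *: p + f *: e2) e1) =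
    - (f1 * dot c e1) - f2 * dot c e2 + 2 * f * dot c p.
  rewrite !crossDl !crossZl cp1 cp2 c12 c21 !(dotDr, dotZr, dotNr).
  move: (dot c p) (dot c e1) (dot c e2) => *; ring.
rewrite W0.
have W1 (v w : 'rV[R]_3) : dot c (cross v w - cross w v) = 2 * dot c (cross v w).
  by rewrite [cross w v]cross_anti opprK dotDr; ring.
rewrite W1 (dot_cross_frame _ _ _ _ _ _ _ fr) !(dotDr, dotZr).
have X1 : dot (cross r p + c - dot c p *: p) e1 = dot c e1 + dot r e2.
  by rewrite !dotDl dotNl dotZl dot_cross cp1 p1 mulr0 subr0 addrC.
have X2 : dot (cross r p + c - dot c p *: p) e2 = dot c e2 - dot r e1.
  by rewrite !dotDl dotNl dotZl dot_cross cp2 p2 mulr0 subr0 dotNr addrC.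
rewrite (dirder_frame _ cK fr) X1 X2 !FE.
have hk := sigma2_frame fr hK.
have hy : density u p ^+ 2 * expR (u p) = 1.
  rewrite /density expr2 -!expRD -[RHS](expR0 R); congr expR.
  by field.
exact: (kazdan_warner_algebra (dirder K p e1) (dirder K p e2) (dirder u p e1) (dirder u p e2)
  (dot r p) (dot r e1) (dot r e2) (dot c p) (dot c e1) (dot c e2) hk hy).
Qed.

(** Only the values of [X] on the coordinate rectangle enter the integral, and
there [X] has the normal form of [conformal_killing_on_sphere]. *)
Lemma sphere_integral_killing X : conformal_killing X ->
  sphere_integral (fun p => dirder K p (X p) * expR (u p)) = 0.
Proof.
move=> kX; have [r [c XE]] := conformal_killing_on_sphere kX.
have cN0 := Ck_cone0 cu; have cN := Ck_cone cu; have cid := @Ck_vec_id 1.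
have [_ I] := null_formD
  (null_formD (null_jac Ck_F (Ck_dot_cst r cid))
    (null_formZ (-8) (null_jac cN0 (Ck_dot_cst r cN))))
  (null_formD (null_formZ (-1) (null_cross c Ck_Fid cid)) (null_formZ 4 (null_cross c cN cN))).
rewrite -[RHS]I; apply: eq_Rintegral => t /[!inE]; rewrite /= in_itv/= => tI.
apply: eq_Rintegral => s /[!inE]; rewrite /= in_itv/= => sI.
congr (_ * _); have fr := frame_sph t s; have [sp t1 t2] := frame_tangent fr.
rewrite XE// (kazdan_warner_frame r c fr) /jac !dirder_dot_cst//.
by rewrite (svderE (svder_id sp t1)) (svderE (svder_id sp t2)).
Qed.

End KazdanWarner.

Theorem theorem1p8 (R : realType) (K : 'rV[R]_3 -> R) :
  Ck_sphere 1 K ->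
  ~ kazdan_warner K ->
  ~ (exists u : 'rV[R]_3 -> R, Ck_sphere 2 u /\ solves_sigma2 K u).
Proof.
move=> cK nkw [u [cu hK]]; apply: nkw; exists (fun p => expR (u p)); split.
- exact: Ck_sphere_expR.
- by move=> p _; exact: expR_gt0.
- by move=> X kX; exact: sphere_integral_killing.
Qed.
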